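(* Let $\Gamma=(\gamma_1,\dots,\gamma_r)$ be a tuple of symmetric free polynomials in $x=(x_1,\dots,x_g)$ with $g\le r$ and $\gamma_j=x_j$ for $1\le j\le g$. Suppose $\mathfrak K\subseteq B(\mathcal H)_{sa}^g$ is a bounded, strong operator topology closed, operator $\Gamma$-convex set that contains $0$, and $\Gamma(0)=0$. If $Y\in B(\mathcal H)^g_{sa}\setminus\mathfrak K$, then there exist a positive integer $N$ and a monic $\Gamma$-pencil $L$ of size $N$ such that $L(X)\succeq0$ for all $X\in\mathfrak K$, but $L(Y)$ is not positive semidefinite.
   Context: $\mathcal H$ is a fixed infinite-dimensional separable complex Hilbert space and $B(\mathcal H)^g_{sa}$ is the set of $g$-tuples of bounded self-adjoint operators on $\mathcal H$, with norm $\|X\|=\max_j\|X_j\|$; the strong operator topology (SOT) on tuples is taken coordinatewise. Free polynomials are elements of the free algebra $\mathbb C\langle x\rangle$ in noncommuting variables, with the conjugate-linear involution fixing each $x_j$ and reversing words; symmetric means $p^*=p$. They are evaluated at $X\in B(\mathcal H)^g_{sa}$ in the obvious way, and $\Gamma(X)=(\gamma_1(X),\dots,\gamma_r(X))$. A set $\mathfrak K\subseteq B(\mathcal H)^g_{sa}$ is free if it is closed under simultaneous unitary similarity and under (finite) direct sums, where $\mathcal H\oplus\cdots\oplus\mathcal H$ is identified with $\mathcal H$ by a unitary. A pair $(X,V)$ with $X\in B(\mathcal H)^g_{sa}$ and $V:\mathcal H\to\mathcal H$ an isometry is an (operator) $\Gamma$-pair if $V^*\Gamma(X)V=\Gamma(V^*XV)$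 (coordinatewise). $\mathfrak K$ is operator $\Gamma$-convex if it is free and $V^*XV\in\mathfrak K$ whenever $X\in\mathfrak K$ and $(X,V)$ is a $\Gamma$-pair. A monic $\Gamma$-pencil of size $N$ is $L=I_N+\sum_{j=1}^rA_j\gamma_j$ with $A_j$ self-adjoint $N\times N$ complex matrices, evaluated by $L(X)=I_N\otimes I_{\mathcal H}+\sum_jA_j\otimes\gamma_j(X)$. *)

(* Defs.v *)
From HB Require Import structures.
From mathcomp Require Import all_boot all_order all_algebra.
From mathcomp Require Import all_classical all_reals all_analysis.
From mathcomp Require Import finmap complex.
(* The notations of monalg clash with those of mathcomp-analysis. *)
From mathcomp Require Import -(notations) monalg.

Set Implicit Arguments.
Unset Strict Implicit.
Unset Printing Implicit Defensive.

Import Order.TTheory GRing.Theory Num.Theory Num.Def.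
Import numFieldNormedType.Exports.

Local Open Scope classical_set_scope.
Local Open Scope complex_scope.
Local Open Scope ring_scope.

(* The inner product is linear in its first argument and conjugate-linear in
   the second one. *)
HB.mixin Record CompleteNormedModule_isHilbert (R : realType) H
    of CompleteNormedModule R[i] H := {
  inner : {dot H for (@conjC R[i])};
  sqr_norm_inner : forall x : H, `|x| ^+ 2 = inner x x
}.

#[short(type="hilbertType")]
HB.structure Definition Hilbert (R : realType) :=
  {H of CompleteNormedModule_isHilbert R H & CompleteNormedModule R[i] H}.

Section Hilbert_space.
Context {R : realType} {H : hilbertType R}.
Local Notation C := R[i].

Definition separable_space := exists D : set H, countable D /\ dense D.

Definition infinite_dimensional :=
  ~ exists n (e : 'I_n -> H), forall x, exists c : 'I_n -> C,
      x = \sum_(i < n) c i *: e i.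

Definition bounded_operator (T : H -> H) := linear T /\ continuous T.

Definition is_adjoint (T S : H -> H) :=
  forall x y, inner (T x) y = inner x (S y).

(* T^*, which is unique by definiteness of the inner product and exists for
   bounded T by the Riesz representation theorem. The default value 0 is only
   met when T has no adjoint. *)
Definition adjoint (T : H -> H) : H -> H :=
  xget (fun=> 0) [set S | is_adjoint T S].

Definition self_adjoint (T : H -> H) := bounded_operator T /\ adjoint T = T.

(* Norms on H are valued in R[i]; Re recovers the real number. *)
Definition opnorm (T : H -> H) : R :=
  sup [set complex.Re `|T x| | x in [set x : H | `|x| <= 1]].

Definition linear_isometry (V : H -> H) := linear V /\ forall x, `|V x| = `|x|.

Definition unitary_operator (U : H -> H) :=
  linear_isometry U /\ forall y, exists x, U x = y.

(* The Hilbert direct sum of n copies of H, which is also C^n (x) H, is the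
   space 'I_n -> H with the following inner product. *)
Definition sum_inner n (u v : 'I_n -> H) : C :=
  \sum_(i < n) inner (u i) (v i).

Definition unitary_from_sum n (Phi : ('I_n -> H) -> H) :=
  [/\ linear Phi,
      forall u v, inner (Phi u) (Phi v) = sum_inner u v
    & forall y, exists u, Phi u = y].

(* 0 <= z in R[i] means that z is real and nonnegative. *)
Definition psd n (T : ('I_n -> H) -> 'I_n -> H) :=
  forall u, 0 <= sum_inner (T u) u.

Definition tensor_op n (A : 'M[C]_n) (T : H -> H) (u : 'I_n -> H) : 'I_n -> H :=
  fun i => \sum_(k < n) A i k *: T (u k).

End Hilbert_space.
Arguments separable_space {R} H.
Arguments infinite_dimensional {R} H.

Section Free_polynomials.
Context {R : realType} {g : nat}.

Definition free_poly := malg (fmonom 'I_g) R[i].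

Definition free_var (j : 'I_g) : free_poly := mkmalgU (fmu j) 1.

Definition free_star (p : free_poly) : free_poly :=
  \sum_(w <- msupp p) mkmalgU (FMonom (rev w)) (conjC (mcoeff w p)).

Definition free_symmetric (p : free_poly) := free_star p = p.

Context {H : hilbertType R}.

Definition word_eval (w : fmonom 'I_g) (X : 'I_g -> H -> H) : H -> H :=
  foldr (fun j T => X j \o T) idfun w.

Definition free_eval (p : free_poly) (X : 'I_g -> H -> H) : H -> H :=
  fun v => \sum_(w <- msupp p) mcoeff w p *: word_eval w X v.

End Free_polynomials.
Arguments free_poly : clear implicits.

Section Gamma_convexity.
Context {R : realType} {H : hilbertType R} {g : nat}.
Local Notation C := R[i].
Implicit Types (X : 'I_g -> H -> H) (K : set ('I_g -> H -> H)).

Definition sa_tuple : set ('I_g -> H -> H) :=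
  [set X | forall j, self_adjoint (X j)].

Definition tuple_norm X : R := \big[maxr/0]_(j < g) opnorm (X j).

Definition bounded_family K := exists M : R, forall X, K X -> tuple_norm X <= M.

(* The strong operator topology is the topology of pointwise convergence on
   H; K is closed in the subspace sa_tuple. *)
Definition sot_closed K :=
  sa_tuple `&` closure (K : set {ptws 'I_g -> {ptws H -> H}}) `<=` K.

(* V^* X V *)
Definition compress m (V : H -> H) (X : 'I_m -> H -> H) : 'I_m -> H -> H :=
  fun j => adjoint V \o X j \o V.

Definition unitarily_closed K :=
  forall X (U : H -> H), K X -> unitary_operator U -> K (compress U X).

(* Z is the direct sum of the tuples X i transported to H along Phi. *)
Definition direct_sum_closed K :=
  forall n (X : 'I_n -> 'I_g -> H -> H) (Phi : ('I_n -> H) -> H)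
      (Z : 'I_g -> H -> H),
    (forall i, K (X i)) -> unitary_from_sum Phi ->
    (forall j u, Z j (Phi u) = Phi (fun i => X i j (u i))) -> K Z.

Definition free_set K :=
  [/\ K `<=` sa_tuple, unitarily_closed K & direct_sum_closed K].

Context {r : nat}.
Implicit Types (G : 'I_r -> free_poly R g).

Definition Gamma_eval G X : 'I_r -> H -> H := fun k => free_eval (G k) X.

Definition Gamma_pair G X (V : H -> H) :=
  [/\ sa_tuple X, linear_isometry V
    & compress V (Gamma_eval G X) = Gamma_eval G (compress V X)].

Definition Gamma_convex G K :=
  free_set K /\
  forall X (V : H -> H), K X -> Gamma_pair G X V -> K (compress V X).

(* The monic Gamma-pencil with coefficients A, evaluated at X. *)
Definition pencil_eval N (A : 'I_r -> 'M[C]_N) G X (u : 'I_N -> H) : 'I_N -> H :=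
  fun i => tensor_op 1%:M idfun u i
           + \sum_(k < r) tensor_op (A k) (Gamma_eval G X k) u i.

End Gamma_convexity.

(* Main.v *)
(** If no pencil separates [Y] from [K], then for every [n] Hahn-Banach in
    finite dimension gives [X] in [K] and vectors [v_i], [i <= n], such that
    all [<v_i, v_l>] and [<gamma_k(X) v_i, v_l>] are within [1/(n+1)] of
    [<e_i, e_l>] and [<gamma_k(Y) e_i, e_l>], where [e] is an orthonormal basis
    of [H]; the cone of matrices involved is convex because [K] is closed under
    direct sums.

    A Gram-Schmidt sequence [b] whose initial segments absorb the [v_k] and the
    [X_j b_k] spans an [X]-reducing subspace, so the isometry [e_k |-> b_k] forms
    a [Gamma]-pair with [X].  Hence one may assume that [X_j e_k] and [v_k] lie
    in the span of an initial segment of [e] whose length depends on [j] and [k]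
    but not on [n].  For such banded tuples, entrywise limits along an
    ultrafilter are strong limits: the tuples converge strongly to some [Z] in
    [K] and the [v_i] to an orthonormal sequence [w_i].  The isometry
    [V : e_i |-> w_i] satisfies [V^* gamma_k(Z) V = gamma_k(Y)]; since the
    coordinates are among the [gamma_k], [(Z, V)] is a [Gamma]-pair and
    [Y = V^* Z V] is in [K]. *)

From HB Require Import structures.
Require Import Defs.
From mathcomp Require Import all_boot all_order all_algebra.
From mathcomp Require Import all_classical all_reals all_analysis.
From mathcomp Require Import finmap complex ring lra zify.
From mathcomp Require Import -(notations) monalg.

Set Implicit Arguments.
Unset Strict Implicit.
Unset Printing Implicit Defensive.

Import Order.TTheory GRing.Theory Num.Theory Num.Def.
Import numFieldNormedType.Exports.

Local Open Scope classical_set_scope.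
Local Open Scope complex_scope.
Local Open Scope ring_scope.

(** * Inner products *)

Section InnerProduct.
Context {R : realType} {H : hilbertType R}.
Local Notation C := R[i].
Implicit Types (x y z : H) (a b : C).

Lemma innerDl x y z : inner (x + y) z = inner x z + inner y z.
Proof. exact: linearDl. Qed.
Lemma innerDr x y z : inner z (x + y) = inner z x + inner z y.
Proof. exact: linearDr. Qed.
Lemma innerBl x y z : inner (x - y) z = inner x z - inner y z.
Proof. exact: linearBl. Qed.
Lemma innerBr x y z : inner z (x - y) = inner z x - inner z y.
Proof. exact: linearBr. Qed.
Lemma innerZl a x y : inner (a *: x) y = a * inner x y.
Proof. exact: linearZl_LR. Qed.
Lemma innerZr a x y : inner x (a *: y) = a^* * inner x y.
Proof. exact: linearZr_LR. Qed.
Lemma inner0l x : inner 0 x = 0.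
Proof. exact: linear0l. Qed.
Lemma inner0r x : inner x 0 = 0.
Proof. exact: linear0r. Qed.
Lemma inner_suml (I : Type) (r : seq I) (P : pred I) (F : I -> H) y :
  inner (\sum_(i <- r | P i) F i) y = \sum_(i <- r | P i) inner (F i) y.
Proof. exact: linear_sumlz. Qed.
Lemma inner_sumr (I : Type) (r : seq I) (P : pred I) (F : I -> H) y :
  inner y (\sum_(i <- r | P i) F i) = \sum_(i <- r | P i) inner y (F i).
Proof. exact: linear_sumr. Qed.
Lemma innerC x y : inner x y = (inner y x)^*.
Proof. by rewrite hermC expr0 mul1r. Qed.
Lemma inner_ge0 x : 0 <= inner x x. Proof. exact: dnorm_ge0. Qed.

Lemma inner_inj x y : (forall z, inner z x = inner z y) -> x = y.
Proof.
move=> h; apply/eqP; rewrite -subr_eq0 -(dnorm_eq0 inner).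
by rewrite innerBr h subrr.
Qed.

Section LinearFunctions.
Context {U V : lmodType C} (T : U -> V) (linT : linear T).

(** Operators are bare functions satisfying the predicate [linear]; packing them gives access to the
    library lemmas on bundled linear maps. *)
Let Tl : {linear U -> V} :=
  HB.pack T (GRing.isLinear.Build C U V *:%R T linT).

Lemma lin0 : T 0 = 0. Proof. exact: (linear0 Tl). Qed.
Lemma linD (x y : U) : T (x + y) = T x + T y. Proof. exact: (linearD Tl). Qed.
Lemma linB (x y : U) : T (x - y) = T x - T y. Proof. exact: (linearB Tl). Qed.
Lemma linZ a (x : U) : T (a *: x) = a *: T x. Proof. exact: (linearZ_LR Tl). Qed.
Lemma lin_sum (I : Type) (r : seq I) (P : pred I) (F : I -> U) :
  T (\sum_(i <- r | P i) F i) = \sum_(i <- r | P i) T (F i).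
Proof. exact: (linear_sum Tl). Qed.
End LinearFunctions.

Lemma normE x : `|x| = sqrtC (inner x x).
Proof. by rewrite -sqr_norm_inner sqrCK// normr_ge0. Qed.

(** The squared norm of [|y|^2 x - <x,y> y] is nonnegative and equals
    [|y|^2 (|x|^2 |y|^2 - |<x,y>|^2)]; divide by [|y|^2]. *)
Lemma cauchy_schwarz x y : `|inner x y| <= `|x| * `|y|.
Proof.
have [->|y0] := eqVneq y 0; first by rewrite inner0r !normr0 mulr0.
have ny : 0 < `|y| ^+ 2 by rewrite exprn_gt0// normr_gt0.
rewrite -ler_sqr ?nnegrE ?mulr_ge0 ?normr_ge0//.
have := inner_ge0 (`|y| ^+ 2 *: x - inner x y *: y).
rewrite innerBl !innerBr !innerZl !innerZr -!sqr_norm_inner (innerC y x).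
have -> : (`|y| ^+ 2)^* = `|y| ^+ 2 by rewrite conj_Creal ?ger0_real ?ltW.
rewrite exprMn normCK => h; rewrite -subr_ge0 -(pmulr_rge0 _ ny).
apply: le_trans h _; rewrite le_eqVlt; apply/orP; left; apply/eqP.
by move: (_ ^*) => w; ring.
Qed.

Lemma cvg_inner (T : Type) (F : set_system T) {FF : Filter F} (f h : T -> H) x y :
  f @ F --> x -> h @ F --> y -> (fun t => inner (f t) (h t) : C^o) @ F --> (inner x y : C^o).
Proof.
move=> fx hy; apply/cvgrPdist_lt => e e0.
have [M M0 hM] : exists2 M : C, 0 < M & \forall t \near F, `|h t| <= M.
  exists (`|y| + 1); first by rewrite ltr_wpDl.
  have /cvgrPdist_lt/(_ 1 ltr01) := hy.
  apply: filterS => t /ltW yt; rewrite -[h t](subrK y) addrC.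
  by rewrite (le_trans (ler_normD _ _))// lerD2l distrC.
near=> t.
have -> : inner x y - inner (f t) (h t) =
   inner x (y - h t) + inner (x - f t) (h t).
  by rewrite innerBr innerBl; ring.
rewrite (le_lt_trans (ler_normD _ _))//.
rewrite [e]splitr ler_ltD//.
  rewrite (le_trans (cauchy_schwarz _ _))//.
  rewrite (@le_trans _ _ ((`|x| + 1) * `|y - h t|)) ?ler_wpM2r ?lerDl//.
  rewrite -ler_pdivlMl ?ltr_wpDl//.
  by near: t; apply: cvgr_dist_le => //; rewrite mulr_gt0 ?invr_gt0 ?ltr_wpDl// divr_gt0.
rewrite (le_lt_trans (cauchy_schwarz _ _))//.
rewrite (@le_lt_trans _ _ (`|x - f t| * M)) ?ler_wpM2l//; first by near: t.
rewrite -ltr_pdivlMr//.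
by near: t; apply: cvgr_dist_lt => //; rewrite !divr_gt0.
Unshelve. all: by end_near. Qed.

Lemma cvg_innerl (T : Type) (F : set_system T) {FF : Filter F} (f : T -> H) x y :
  f @ F --> x -> (fun t => inner (f t) y : C^o) @ F --> (inner x y : C^o).
Proof. by move=> fx; apply: cvg_inner => //; apply: cvg_cst. Qed.

Lemma cvg_innerr (T : Type) (F : set_system T) {FF : Filter F} (f : T -> H) x y :
  f @ F --> y -> (fun t => inner x (f t) : C^o) @ F --> (inner x y : C^o).
Proof. by move=> fx; apply: cvg_inner => //; apply: cvg_cst. Qed.

Lemma scalar_cvg_unique (T : Type) (F : set_system T) {FF : ProperFilter F}
    (f : T -> C^o) (a b : C) : f @ F --> (a : C^o) -> f @ F --> (b : C^o) -> a = b.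
Proof. exact: norm_cvg_unique. Qed.

Lemma vector_cvg_unique (T : Type) (F : set_system T) {FF : ProperFilter F}
    (f : T -> H) x y : f @ F --> x -> f @ F --> y -> x = y.
Proof. exact: norm_cvg_unique. Qed.

End InnerProduct.
Arguments cvg_innerl {R H T F FF f x} y _.
Arguments cvg_innerr {R H T F FF f} x {y} _.

(** * Orthonormal sequences *)

Section Orthonormal.
Context {R : realType} {H : hilbertType R}.
Local Notation C := R[i].
Implicit Types (x y z : H) (e b : nat -> H).

Definition orthonormal_seq b := forall i j, inner (b i) (b j) = (i == j)%:R.

(** Coefficients are read along [e] and placed on [b]. For [b = e] this is the partial Fourier sum;
    in general it is a partial sum of the operator carrying [e] to [b]. *)
Definition fourier_sum e b n x := \sum_(0 <= k < n) inner x (e k) *: b k.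

Lemma inner_sum_orthonormal b (c : nat -> C) m n j : orthonormal_seq b ->
  inner (\sum_(m <= k < n) c k *: b k) (b j) = if (m <= j < n)%N then c j else 0.
Proof.
move=> ob; rewrite inner_suml.
under eq_bigr do rewrite innerZl ob.
case: ifP => hj.
  rewrite (bigD1_seq j) ?mem_index_iota ?iota_uniq//= eqxx mulr1 big1 ?addr0//.
  by move=> i /negPf ->; rewrite mulr0.
rewrite big_seq big1// => i; rewrite mem_index_iota => hi.
by case: eqVneq => [ij|_]; rewrite ?mulr0//; rewrite -ij hi in hj.
Qed.

Lemma sqr_norm_sum_orthonormal b (c : nat -> C) m n : orthonormal_seq b ->
  `|\sum_(m <= k < n) c k *: b k| ^+ 2 = \sum_(m <= k < n) `|c k| ^+ 2.
Proof.
move=> ob; rewrite sqr_norm_inner inner_sumr; apply: eq_big_nat => i hi.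
by rewrite innerZr inner_sum_orthonormal// hi mulrC normCK.
Qed.

Lemma bessel e n x : orthonormal_seq e ->
  \sum_(0 <= k < n) `|inner x (e k)| ^+ 2 <= `|x| ^+ 2.
Proof.
move=> oe; rewrite -subr_ge0.
have := inner_ge0 (x - fourier_sum e e n x).
have h : inner x (fourier_sum e e n x) = \sum_(0 <= k < n) `|inner x (e k)| ^+ 2.
  by rewrite inner_sumr; apply: eq_bigr => k _; rewrite innerZr mulrC normCK.
rewrite innerBl !innerBr -!sqr_norm_inner sqr_norm_sum_orthonormal//.
rewrite (innerC _ x) h conj_Creal ?subrr ?subr0//.
by rewrite ger0_real// sumr_ge0// => i _; rewrite exprn_ge0.
Qed.

(** The partial sums of [|c k|^2] increase to a supremum. Once they are within [e^2] of it,
    Pythagoras bounds every later block of the series by [e], and completeness applies. *)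
Lemma is_cvg_sum_orthonormal b (c : nat -> C) (M : C) : orthonormal_seq b ->
  (forall n, \sum_(0 <= k < n) `|c k| ^+ 2 <= M) ->
  cvgn (fun n => \sum_(0 <= k < n) c k *: b k).
Proof.
move=> ob cM; apply/cauchy_cvgP; apply: cauchy_exP => e e0.
pose s n := complex.Re (\sum_(0 <= k < n) `|c k| ^+ 2).
have sE n : \sum_(0 <= k < n) `|c k| ^+ 2 = (s n)%:C.
  rewrite RRe_real// ger0_real// sumr_ge0// => i _; exact: exprn_ge0.
have eE : e = (complex.Re e)%:C by rewrite RRe_real// gtr0_real.
have re0 : 0 < complex.Re e by move: e0; rewrite eE ltcR.
have hs : has_sup (range s).
  split; first by exists (s 0%N); exists 0%N.
  exists (complex.Re M) => _ [n _ <-].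
  by have := cM n; rewrite lecE => /andP[].
have [_ [N _ <-] hN] := sup_adherent (exprn_gt0 2 re0) hs.
exists (\sum_(0 <= k < N) c k *: b k); exists N => // n /= Nn.
rewrite -ball_normE/= distrC (big_cat_nat (n := N))//= addrAC subrr add0r.
rewrite -ltr_sqr ?nnegrE ?(ltW e0)// sqr_norm_sum_orthonormal//.
have -> : \sum_(N <= k < n) `|c k| ^+ 2 = (s n - s N)%:C.
  by rewrite rmorphB/= -!sE [in RHS](big_cat_nat (n := N))//= addrAC subrr add0r.
rewrite eE -rmorphXn ltcR ltrBlDl -ltrBlDr (le_lt_trans _ hN)// lerB//.
by apply: ub_le_sup; [case: hs | exists n].
Qed.

(* The operator sending [e k] to [b k] and vanishing on the orthogonal
   complement of the [e k]. *)
Definition frame_op e b x : H := limn (fun n => fourier_sum e b n x).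

Lemma frame_op_cvg e b x : orthonormal_seq e -> orthonormal_seq b ->
  fourier_sum e b n x @[n --> \oo] --> frame_op e b x.
Proof.
move=> oe ob; apply: (is_cvg_sum_orthonormal (M := `|x| ^+ 2)) => // n.
exact: bessel.
Qed.
Arguments frame_op_cvg [e b] x.

(** Exchanging the two sequences gives the adjoint: the identity is exact on partial sums and passes
    to the limit. *)
Lemma frame_op_adj e b x y : orthonormal_seq e -> orthonormal_seq b ->
  inner (frame_op e b x) y = inner x (frame_op b e y).
Proof.
move=> oe ob.
apply: (scalar_cvg_unique (cvg_innerl y (frame_op_cvg x oe ob))).
have h2 := cvg_innerr x (frame_op_cvg y ob oe).
rewrite [X in X @ _](_ : _ = fun n => inner x (fourier_sum b e n y)); first exact: h2.
apply/funext => n; rewrite inner_suml inner_sumr; apply: eq_bigr => k _.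
by rewrite innerZl innerZr -innerC mulrC.
Qed.

(** A map with an adjoint is linear, so no limit has to be taken. *)
Lemma frame_op_linear e b : orthonormal_seq e -> orthonormal_seq b ->
  linear (frame_op e b).
Proof.
move=> oe ob a x y; apply: inner_inj => z.
by rewrite innerDr innerZr -!frame_op_adj// innerDr innerZr.
Qed.

Lemma inner_frame_op e b x k : orthonormal_seq e -> orthonormal_seq b ->
  inner (frame_op e b x) (b k) = inner x (e k).
Proof.
move=> oe ob.
apply: (scalar_cvg_unique (cvg_innerl (b k) (frame_op_cvg x oe ob))).
apply: cvg_near_cst; exists k.+1 => //= n kn.
by rewrite inner_sum_orthonormal// kn.
Qed.

Lemma frame_op_orth e b x : orthonormal_seq e -> orthonormal_seq b ->
  (forall k, inner x (e k) = 0) -> frame_op e b x = 0.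
Proof.
move=> oe ob hx; apply: (vector_cvg_unique (frame_op_cvg x oe ob)).
apply: cvg_near_cst; apply: nearW => n.
by rewrite /fourier_sum big1// => k _; rewrite hx scale0r.
Qed.

Lemma frame_op_seq e b k : orthonormal_seq e -> orthonormal_seq b ->
  frame_op e b (e k) = b k.
Proof.
move=> oe ob; apply: inner_inj => z.
by rewrite -frame_op_adj// inner_frame_op.
Qed.

Lemma frame_op_comp e b b' x : orthonormal_seq e -> orthonormal_seq b ->
  frame_op b b' (frame_op e b x) = frame_op e b' x.
Proof.
move=> oe ob; rewrite /frame_op /fourier_sum.
by under eq_fun do under eq_bigr do rewrite inner_frame_op//.
Qed.

(** With [W = frame_op e b] and [P = frame_op e e], one has [|Wx|^2 = <x, Px>] and [|Wx| = |Px|], so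
    Cauchy-Schwarz gives [|Wx|^2 <= |x| |Wx|]. *)
Lemma frame_op_contraction e b x : orthonormal_seq e -> orthonormal_seq b ->
  `|frame_op e b x| <= `|x|.
Proof.
move=> oe ob.
have [->|n0] := eqVneq (`|frame_op e b x|) 0; first exact: normr_ge0.
have pn : 0 < `|frame_op e b x| by rewrite lt_def n0 normr_ge0.
have h : inner (frame_op e b x) (frame_op e b x) = inner x (frame_op e e x).
  by rewrite frame_op_adj// frame_op_comp.
have h2 : `|frame_op e b x| = `|frame_op e e x|.
  by rewrite !normE h frame_op_adj// frame_op_comp.
rewrite -(ler_pM2r pn) -expr2 sqr_norm_inner h h2.
by rewrite (le_trans (real_ler_norm _))// ?cauchy_schwarz// -h ger0_real// inner_ge0.
Qed.

(** For orthonormal [e]: every vector is the sum of its Fourier series, so [e] is a Hilbert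
    basis. *)
Definition complete_seq e := forall x, frame_op e e x = x.

Lemma frame_op_isometry e b : orthonormal_seq e -> orthonormal_seq b ->
  complete_seq e -> linear_isometry (frame_op e b).
Proof.
move=> oe ob ce; split; first exact: frame_op_linear.
by move=> x; rewrite !normE frame_op_adj// frame_op_comp// ce.
Qed.

(** Membership in the span of the first [n] vectors of an orthonormal [b], encoded as a fixed-point
    equation of the projection so that it can be used for rewriting. *)
Definition in_span b n x := x = fourier_sum b b n x.

Lemma in_spanW b m n x : orthonormal_seq b -> (m <= n)%N ->
  in_span b m x -> in_span b n x.
Proof.
move=> ob mn hx; rewrite /in_span /fourier_sum (big_cat_nat (n := m))//=.
rewrite -[X in X + _]hx big_nat_cond big1 ?addr0// => i /andP[/andP[mi _] _].
by rewrite hx inner_sum_orthonormal// ltnNge mi/= scale0r.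
Qed.

Lemma in_span_frame_op b n x : orthonormal_seq b ->
  in_span b n x -> frame_op b b x = x.
Proof.
move=> ob hx; apply: (vector_cvg_unique (frame_op_cvg x ob ob)).
by apply: cvg_near_cst; exists n => //= k nk; exact/esym/(in_spanW ob nk hx).
Qed.

(** If [t] is outside the span of the first [n] vectors, [v] is its normalised residue. Otherwise
    [v] is the normalised residue of some vector outside the span, which exists in infinite
    dimension; the sequence thus never stops. *)
Lemma gram_schmidt_step b n t : infinite_dimensional H ->
  (forall i j, (i < n)%N -> (j < n)%N -> inner (b i) (b j) = (i == j)%:R) ->
  exists v, [/\ inner v v = 1, forall i, (i < n)%N -> inner v (b i) = 0
    & t = fourier_sum b b n t + inner t v *: v].
Proof.
move=> infH ob.
pose res y := y - fourier_sum b b n y.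
have res_orth y i : (i < n)%N -> inner (res y) (b i) = 0.
  move=> ni; rewrite innerBl inner_suml big_nat_cond.
  rewrite (eq_bigr (fun k => inner y (b k) * (k == i)%:R)); last first.
    by move=> k /andP[/andP[_ kn] _]; rewrite innerZl ob.
  rewrite -big_nat_cond (bigD1_seq i) ?mem_index_iota ?iota_uniq//= eqxx mulr1.
  rewrite big1 ?addr0 ?subrr// => k /negPf ->; rewrite mulr0//.
have unitv y : res y != 0 -> exists v, [/\ inner v v = 1,
    forall i, (i < n)%N -> inner v (b i) = 0 & res y = inner (res y) v *: v].
  move=> ry; have nr : `|res y| != 0 by rewrite normr_eq0.
  have nc : (`|res y|^-1)^* = `|res y|^-1.
    by rewrite conj_Creal// ger0_real// invr_ge0.
  exists (`|res y|^-1 *: res y); split.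
  - by rewrite innerZl innerZr nc -sqr_norm_inner; field.
  - by move=> i ni; rewrite innerZl res_orth ?mulr0.
  - rewrite innerZr nc -sqr_norm_inner scalerA.
    rewrite (_ : _ * _ = 1) ?scale1r//; by field.
have fv v y : (forall i, (i < n)%N -> inner v (b i) = 0) ->
    inner y v = inner (res y) v.
  move=> hv; rewrite innerBl inner_suml big_nat_cond big1 ?subr0//.
  by move=> i /andP[/andP[_ ni] _]; rewrite innerZl (innerC _ v) hv// conjC0 mulr0.
have [rt|rt] := eqVneq (res t) 0; last first.
  have [v [v1 v2 v3]] := unitv _ rt; exists v; split=> //.
  by rewrite (fv v)// -v3 addrC subrK.
have [y ry] : exists y, res y != 0.
  apply: contrapT => hy; apply: infH; exists n, (fun i : 'I_n => b i) => x.
  exists (fun i : 'I_n => inner x (b i)); apply/eqP.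
  rewrite -(big_mkord xpredT (fun k => inner x (b k) *: b k)) -subr_eq0.
  by apply/negPn/negP => h; apply: hy; exists x.
have [v [v1 v2 v3]] := unitv _ ry; exists v; split=> //.
by rewrite (fv v)// rt inner0l scale0r addr0; apply/eqP; rewrite -subr_eq0; apply/eqP.
Qed.

(** The vector absorbed at step [n] is computed from the list of vectors already built, so that it
    may be the image of an earlier one, as in [krylov_basis]. *)
Lemma gram_schmidt (T : seq H -> H) : infinite_dimensional H ->
  exists2 b, orthonormal_seq b & forall n, in_span b n.+1 (T (mkseq b n)).
Proof.
move=> infH.
pose P (s : seq H) (v : H) := [/\ inner v v = 1,
  (forall i, (i < size s)%N -> inner v (nth 0 s i) = 0)
  & T s = \sum_(z <- s) inner (T s) z *: z + inner (T s) v *: v].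
(* The default 0 is never met on the lists [B n], since [gram_schmidt_step] provides a witness
   there. *)
pose next (s : seq H) : H := xget 0 [set v | P s v].
pose B := fix B n := if n is m.+1 then rcons (B m) (next (B m)) else [::].
pose b n : H := next (B n).
have BE n : B n = mkseq b n by elim: n => //= n IH; rewrite mkseqS -IH.
have Pb n : P (mkseq b n) (b n) /\
    forall i j, (i < n)%N -> (j < n)%N -> inner (b i) (b j) = (i == j)%:R.
  elim/ltn_ind: n => n IH.
  have ob i j : (i < n)%N -> (j < n)%N -> inner (b i) (b j) = (i == j)%:R.
    wlog ij : i j / (i <= j)%N => [hw|] ni nj.
      have [|ji] := leqP i j; first by move=> ?; apply: hw.
      by rewrite innerC hw// ?conjC_nat ?(eq_sym j)// ltnW.
    have [[h1 h2 _] _] := IH _ nj.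
    move: ij; rewrite leq_eqVlt => /orP[/eqP ->|ij]; first by rewrite h1 eqxx.
    move: (h2 i); rewrite size_mkseq nth_mkseq// => h2i.
    by rewrite innerC h2i// conjC0 ltn_eqF.
  split=> //.
  rewrite -BE /b /next; apply: (@xgetPex _ 0 [set v | P (B n) v]).
  have [v [v1 v2 v3]] := gram_schmidt_step (T (B n)) infH ob.
  exists v; split=> //.
    by move=> i; rewrite BE size_mkseq => hi; rewrite nth_mkseq// v2.
  by rewrite [LHS]v3 {3}BE /fourier_sum /index_iota subn0 big_map.
exists b => [i j|n]; first by have [_] := Pb (maxn i j).+1; apply; lia.
have [[_ _ h] _] := Pb n.
by rewrite /in_span [LHS]h /fourier_sum big_nat_recr//= /index_iota subn0 big_map.
Qed.

(** Gram-Schmidt absorbs a sequence [q] covering a dense set, [q n] at step [n]. The contraction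
    [frame_op e e] fixes that dense set, hence every vector. *)
Lemma complete_seq_exists : separable_space H -> infinite_dimensional H ->
  exists2 e, orthonormal_seq e & complete_seq e.
Proof.
move=> [D [cD dD]] infH.
have [q hq] : exists q : nat -> H, D `<=` range q.
  have /pfcard_geP[D0|[f]] := cD.
    by exists (fun=> 0) => x; rewrite D0.
  exists f => x Dx; have [n _ <-] := 'surj_f Dx; by exists n.
have [e oe he] := gram_schmidt (fun s => q (size s)) infH.
exists e => // x.
suff key d : 0 < d -> `|frame_op e e x - x| <= d.
  apply/eqP; rewrite -subr_eq0; apply/negPn/negP; rewrite -normr_gt0 => n0.
  have := key _ (divr_gt0 n0 (ltr0Sn C 1)) => /le_gtF/negP; apply.
  by rewrite ltr_pdivrMr// mulr_natr mulr2n ltrDl.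
move=> d0.
have d20 : 0 < d / 2 by rewrite divr_gt0.
have [z [xz Dz]] : ball x (d / 2) `&` D !=set0.
  apply: dD; last exact: ball_open.
  by exists x; apply: ballxx.
have [n _ qn] := hq _ Dz.
have hz : frame_op e e z = z.
  apply: (in_span_frame_op (n := n.+1)) => //.
  by have := he n; rewrite size_mkseq qn.
have -> : frame_op e e x - x = frame_op e e (x - z) - (x - z).
  by rewrite (linB (frame_op_linear oe oe)) hz opprB addrA subrK.
rewrite (le_trans (ler_normB _ _))// [d]splitr lerD//.
  rewrite (le_trans (frame_op_contraction _ oe oe))//.
  by move: xz; rewrite -ball_normE => /ltW.
by move: xz; rewrite -ball_normE => /ltW.
Qed.

End Orthonormal.
Arguments frame_op_cvg {R H e b} x.

(** * Operators and free polynomials *)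

Section Operators.
Context {R : realType} {H : hilbertType R}.
Local Notation C := R[i].
Implicit Types (x y z : H) (S T : H -> H).

Lemma adjoint_eq T S : is_adjoint T S -> adjoint T = S.
Proof.
move=> h; have hT : is_adjoint T (adjoint T).
  by apply: (xgetPex _ (P := [set S | is_adjoint T S])); exists S.
by apply/funext => y; apply: inner_inj => z; rewrite -hT h.
Qed.

Lemma self_adjoint_is_adjoint T : self_adjoint T -> is_adjoint T T.
Proof.
move=> [_ aT].
have [[S hS]|nS] := pselect (exists S, is_adjoint T S).
  by rewrite -{2}aT (adjoint_eq hS).
(* Without an adjoint, [adjoint T] is the default value [0], so [T = 0]. *)
have T0 : T = fun=> 0.
  by rewrite -aT /adjoint xgetPN// => S hS; apply: nS; exists S.
by move=> x y; rewrite T0 inner0l inner0r.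
Qed.

Lemma bounded_operator_bound T : bounded_operator T ->
  exists2 M : C, 0 < M & forall x, `|T x| <= M * `|x|.
Proof.
move=> [linT cT].
pose Tl : {linear H -> H} := HB.pack T (GRing.isLinear.Build C H H *:%R T linT).
have /linear_boundedP/pinfty_ex_gt0[M M0 hM] :=
  continuous_linear_bounded 0 (f := Tl) (cT 0).
by exists M.
Qed.

Lemma bounded_operator_intro T (M : C) : linear T ->
  (forall x, `|T x| <= M * `|x|) -> bounded_operator T.
Proof.
move=> linT hM; split=> //.
pose Tl : {linear H -> H} := HB.pack T (GRing.isLinear.Build C H H *:%R T linT).
apply: (bounded_linear_continuous (f := Tl)).
apply/linear_boundedP.
have hM' x : `|T x| <= `|M| * `|x|.
  rewrite -(normr_id x) -normrM -(normr_id (T x)).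
  by rewrite ger0_le_norm ?nnegrE// (le_trans _ (hM x)).
exists `|M|; split; first exact: normr_real.
by move=> r /= Mr x; rewrite (le_trans (hM' x))// ler_wpM2r// ltW.
Qed.

Lemma opnorm_bound T (M : R) x : bounded_operator T -> opnorm T <= M ->
  `|T x| <= M%:C * `|x|.
Proof.
move=> bT TM; have [B B0 hB] := bounded_operator_bound bT.
have [->|x0] := eqVneq x 0; first by rewrite (lin0 bT.1) !normr0 mulr0.
have nx : 0 < `|x| by rewrite normr_gt0.
have nV : `| `|x|^-1 | = `|x|^-1 by rewrite ger0_norm// invr_ge0.
have ny : `| `|x|^-1 *: x | = 1 by rewrite normrZ nV mulVf// gt_eqF.
have hy : complex.Re `|T (`|x|^-1 *: x)| <= opnorm T.
  apply: ub_le_sup; last by exists (`|x|^-1 *: x) => //=; rewrite ny.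
  exists (complex.Re B) => _ [z /= z1 <-].
  have : `|T z| <= B by rewrite (le_trans (hB z))// ler_piMr// ltW.
  by rewrite lecE => /andP[].
have : `|T (`|x|^-1 *: x)| <= M%:C.
  by rewrite -[leLHS]RRe_real ?normr_real// lecR (le_trans hy).
by rewrite (linZ bT.1) normrZ nV mulrC ler_pdivrMr.
Qed.

Context {g : nat}.
Implicit Types (X : 'I_g -> H -> H) (s : seq 'I_g).

Definition tuple_bound (M : C) X := forall j x, `|X j x| <= M * `|x|.

Lemma bounded_family_bound (K : set ('I_g -> H -> H)) : K `<=` sa_tuple ->
  bounded_family K -> exists2 M : C, 1 <= M & forall X, K X -> tuple_bound M X.
Proof.
move=> Ksa [M hM]; exists (maxr 1 M)%:C; first by rewrite (_ : 1 = 1%:C)// lecR le_max lexx.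
move=> X KX j x; apply: opnorm_bound; first by have [] := Ksa _ KX j.
rewrite le_max; apply/orP; right; apply: le_trans (hM _ KX).
exact: (le_bigmax _ (fun j => opnorm (X j)) j).
Qed.

(** This is [word_eval] on bare lists, convertible to it, and suited to induction and
    concatenation. *)
Definition seq_eval s X : H -> H := foldr (fun j T => X j \o T) idfun s.

Lemma seq_eval_linear s X : (forall j, linear (X j)) -> linear (seq_eval s X).
Proof.
move=> hX; elim: s => [|j s IH] a x y //=.
by rewrite /seq_eval/= -/(seq_eval s X) IH hX.
Qed.

Lemma seq_eval_cat s t X x : seq_eval (s ++ t) X x = seq_eval s X (seq_eval t X x).
Proof. by elim: s => //= j s ->. Qed.

Lemma seq_eval_adj s X : (forall j, is_adjoint (X j) (X j)) ->
  is_adjoint (seq_eval s X) (seq_eval (rev s) X).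
Proof.
move=> hX; elim: s => [|j s IH] x y //=.
by rewrite rev_cons -cats1 seq_eval_cat /= -IH hX.
Qed.

Lemma seq_eval_bound s X (M : C) x : 0 <= M -> tuple_bound M X ->
  `|seq_eval s X x| <= M ^+ size s * `|x|.
Proof.
move=> M0 hX; elim: s => [|j s IH] /=; first by rewrite mul1r.
by rewrite (le_trans (hX _ _))// exprS -mulrA ler_wpM2l.
Qed.

Lemma free_evalE (p : free_poly R g) X x :
  free_eval p X x = \sum_(w <- msupp p) mcoeff w p *: seq_eval w X x.
Proof. by []. Qed.

Lemma free_eval_linear (p : free_poly R g) X : (forall j, linear (X j)) ->
  linear (free_eval p X).
Proof.
move=> hX a x y; rewrite !free_evalE scaler_sumr -big_split; apply: eq_bigr => w _ /=.
rewrite (linD (seq_eval_linear w hX)) (linZ (seq_eval_linear w hX)) scalerDr.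
by rewrite !scalerA mulrC.
Qed.

(** The bound depends on [p] and [M] only and is thus uniform over the tuples bounded by [M]. *)
Lemma free_eval_bound (p : free_poly R g) (M : C) : 0 <= M ->
  exists2 B : C, 0 <= B & forall X x, tuple_bound M X ->
    `|free_eval p X x| <= B * `|x|.
Proof.
move=> M0; exists (\sum_(w <- msupp p) `|mcoeff w p| * M ^+ size w).
  by apply: sumr_ge0 => w _; rewrite mulr_ge0 ?exprn_ge0.
move=> X x hX; rewrite free_evalE (le_trans (ler_norm_sum _ _ _))// mulr_suml.
apply: ler_sum => w _; rewrite normrZ -mulrA ler_wpM2l//.
exact: seq_eval_bound.
Qed.

Lemma free_eval_intertwine (p : free_poly R g) X Z (W : H -> H) x : linear W ->
  (forall j y, X j (W y) = W (Z j y)) ->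
  free_eval p X (W x) = W (free_eval p Z x).
Proof.
move=> lW h; rewrite !free_evalE (lin_sum lW); apply: eq_bigr => w _.
rewrite (linZ lW); congr (_ *: _).
by elim: (w : seq _) => //= j s IH; rewrite -[RHS]h -IH.
Qed.

Lemma free_eval_var (j : 'I_g) X x : free_eval (free_var j) X x = X j x.
Proof.
rewrite free_evalE msuppU oner_eq0 big_seq_fset1 mcoeffUU scale1r.
by rewrite fmuE.
Qed.

Definition rev_fmonom (w : fmonom 'I_g) : fmonom 'I_g := FMonom (rev w).

Lemma rev_fmonomK : involutive rev_fmonom.
Proof. by case=> s; rewrite /rev_fmonom/= revK. Qed.

Lemma mcoeff_free_star (p : free_poly R g) w :
  mcoeff w (free_star p) = (mcoeff (rev_fmonom w) p)^*.
Proof.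
rewrite /free_star raddf_sum/=.
have revE (w' : fmonom 'I_g) : (FMonom (rev w') == w) = (w' == rev_fmonom w).
  by rewrite -[FMonom _]/(rev_fmonom w') -{1}[w]rev_fmonomK (inj_eq (can_inj rev_fmonomK)).
under eq_bigr do rewrite mcoeffU revE.
have [h|h] := boolP (rev_fmonom w \in msupp p).
  rewrite (bigD1_seq (rev_fmonom w)) ?fset_uniq//= eqxx mulr1n big1 ?addr0//.
  by move=> i /negPf ->; rewrite mulr0n.
rewrite (mcoeff_outdom h) conjC0 big_seq big1// => i hi.
by case: eqVneq => [ie|_]; rewrite ?mulr0n// -ie hi in h.
Qed.

(** By symmetry, coefficients at a word and at its reversal are conjugate and the support is stable
    under reversal; reindexing the sum by reversal matches the two sides. *)
Lemma free_eval_adj (p : free_poly R g) X : free_symmetric p ->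
  (forall j, is_adjoint (X j) (X j)) ->
  is_adjoint (free_eval p X) (free_eval p X).
Proof.
move=> hp hX x y.
have hc w : (mcoeff w p)^* = mcoeff (rev_fmonom w) p.
  by rewrite -[p in RHS]hp mcoeff_free_star rev_fmonomK.
have hs w : (rev_fmonom w \in msupp p) = (w \in msupp p).
  by rewrite -!mcoeff_neq0 -hc conjC_eq0.
rewrite !free_evalE inner_suml inner_sumr.
under eq_bigr do rewrite innerZl (seq_eval_adj _ hX) -[mcoeff _ _]conjCK hc.
under [RHS]eq_bigr do rewrite innerZr.
rewrite -(big_map rev_fmonom xpredT
  (fun w => (mcoeff w p)^* * inner x (seq_eval w X y))).
apply: perm_big; apply: uniq_perm.
- by rewrite map_inj_uniq ?fset_uniq//; apply: can_inj rev_fmonomK.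
- exact: fset_uniq.
- move=> w; rewrite -[w]rev_fmonomK (mem_map (can_inj rev_fmonomK)).
  by rewrite [RHS]hs.
Qed.

End Operators.

(** * Limits along an ultrafilter *)

Section UltraLimits.
Context {R : realType} {H : hilbertType R}.
Local Notation C := R[i].
Context {I : Type} (U : set_system I) {UU : UltraFilter U}.

Lemma ultra_fmap (J : Type) (f : I -> J) : UltraFilter (f @ U).
Proof.
split=> [|G GF sG]; first exact: fmap_proper_filter.
apply/seteqP; split=> // A GA.
have [//|UA] := in_ultra_setVsetC (f @^-1` A) UU.
have GnA : G (~` A) by apply: sG.
have : G (A `&` ~` A) by apply: filterI.
by rewrite setICr => /filter_not_empty.
Qed.

Lemma ultra_bounded_real_cvg (z : I -> R) (M : R) :
  (\forall n \near U, `|z n| <= M) -> exists l : R, z @ U --> l.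
Proof.
move=> hz; have := @segment_compact R (- M) M.
rewrite compact_ultra => /(_ (z @ U) (ultra_fmap z)) [|l [_ zl]]; last by exists l.
have : U (z @^-1` `[- M, M]%classic).
  by apply: filterS hz => n /=; rewrite in_itv/= ler_norml.
exact.
Qed.

Lemma ultra_bounded_complex_cvg (z : I -> C) (M : C) :
  (\forall n \near U, `|z n| <= M) -> exists l : C, (z : I -> C^o) @ U --> (l : C^o).
Proof.
move=> hz.
have ni : `|'i%C : C| = 1 by rewrite normc_def/= expr0n add0r expr1n sqrtr1.
have [a ha] : exists a : R, (fun n => complex.Re (z n)) @ U --> a.
  apply: (@ultra_bounded_real_cvg _ (complex.Re M)); apply: filterS hz => n hn.
  by have := le_trans (normc_ge_Re _) hn; rewrite lecE => /andP[].
have [b hb] : exists b : R, (fun n => complex.Im (z n)) @ U --> b.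
  apply: (@ultra_bounded_real_cvg _ (complex.Re M)); apply: filterS hz => n hn.
  (* The imaginary part of [z] is minus the real part of [z i], so the bound for real parts
     applies. *)
  have : `|z n * 'i%C| <= M by rewrite normrM ni mulr1.
  by move=> /(le_trans (normc_ge_Re _)); rewrite ReiNIm normrN lecE => /andP[].
exists (a +i* b); apply/cvgrPdist_lt => d d0.
have dE : d = (complex.Re d)%:C by rewrite RRe_real// gtr0_real.
have d2 : 0 < complex.Re d / 2 by move: d0; rewrite dE ltcR => ?; rewrite divr_gt0.
near=> n.
have -> : (a +i* b : C) - z n = (a - complex.Re (z n))%:C + 'i%C * (b - complex.Im (z n))%:C.
  by case: (z n) => p q; simpc.
rewrite (le_lt_trans (ler_normD _ _))// normrM.
rewrite ni mul1r !normc_def/= !expr0n/= !addr0 !sqrtr_sqr -rmorphD/= dE ltcR.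
rewrite [X in _ < X]splitr ltrD//.
  by near: n; apply: cvgr_dist_lt.
by near: n; apply: cvgr_dist_lt.
Unshelve. all: by end_near. Qed.

(** In a fixed finite-dimensional span the finitely many bounded coefficients converge, which gives
    norm convergence; this is the purpose of the bands. *)
Lemma ultra_in_span_cvg (e : nat -> H) d (x : I -> H) (M : C) :
  (forall n, in_span e d (x n)) -> (\forall n \near U, `|x n| <= M) ->
  exists y : H, x @ U --> y.
Proof.
move=> hx hM.
have /choice[l hl] (k : nat) : exists l : C,
    ((fun n => inner (x n) (e k)) : I -> C^o) @ U --> (l : C^o).
  apply: (@ultra_bounded_complex_cvg _ (M * `|e k|)); apply: filterS hM => n hn.
  by rewrite (le_trans (cauchy_schwarz _ _))// ler_wpM2r.
exists (\sum_(0 <= k < d) l k *: e k).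
rewrite (_ : x = fun n => \sum_(0 <= k < d) inner (x n) (e k) *: e k); last first.
  by apply/funext => n; rewrite [LHS]hx.
apply: (cvg_big (op := +%R)) => [|k _]; first exact: add_continuous.
apply: cvgZr_tmp; exact: hl.
Qed.

(** Write [T n (v n) = T n w + T n (v n - w)]; the uniform bound sends the last term to 0. *)
Lemma cvg_apply (T : I -> H -> H) (Too : H -> H) (v : I -> H) w (M : C) :
  0 <= M -> (forall n, linear (T n)) -> (forall n x, `|T n x| <= M * `|x|) ->
  (fun n => T n w) @ U --> Too w -> v @ U --> w -> (fun n => T n (v n)) @ U --> Too w.
Proof.
move=> M0 lT hT hw hv.
have M1 : 0 < M + 1 by rewrite ltr_wpDl.
have h : (fun n => T n w + T n (v n - w)) @ U --> Too w + 0.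
  apply: cvgD => //; apply/cvgr0Pnorm_lt => d d0; near=> n.
  rewrite (le_lt_trans (hT _ _))// (@le_lt_trans _ _ ((M + 1) * `|v n - w|))//.
    by rewrite ler_wpM2r// lerDl.
  rewrite -ltr_pdivlMl// distrC; near: n.
  by apply: cvgr_dist_lt => //; rewrite mulr_gt0// invr_gt0.
rewrite addr0 in h; apply: cvg_trans h; apply: near_eq_cvg; apply: nearW => n.
by rewrite -(linD (lT n)) addrC subrK.
Unshelve. all: by end_near. Qed.

End UltraLimits.

Lemma ptws_cvg (I J : Type) (T : topologicalType) (U : set_system I)
    {FU : Filter U} (F : I -> J -> T) (f : J -> T) :
  (forall j, (fun n => F n j) @ U --> f j) ->
  (F : I -> {ptws J -> T}) @ U --> (f : {ptws J -> T}).
Proof.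
move=> h; apply/cvg_sup => j A [B] [[W] oW <-] Wf WA; apply: (filterS WA).
by apply: h; apply: open_nbhs_nbhs; split.
Qed.

(** * Strong limits of banded operators and of polynomials in them *)

Section StrongLimits.
Context {R : realType} {H : hilbertType R}.
Local Notation C := R[i].

(** Completeness gives [T (e i) = S (e i)], so [T'] and [S'] have the same coefficients and
    coincide, and then so do [T] and [S]. The existence of adjoints does the work of linearity and
    continuity. *)
Lemma matrix_coef_inj (e : nat -> H) (T T' S S' : H -> H) :
  orthonormal_seq e -> complete_seq e -> is_adjoint T T' -> is_adjoint S S' ->
  (forall i l, inner (T (e i)) (e l) = inner (S (e i)) (e l)) -> T = S.
Proof.
move=> oe ce hT hS h.
have vanish z : (forall k, inner z (e k) = 0) -> z = 0.
  by move=> hz; rewrite -[LHS]ce frame_op_orth.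
have hTS y : T' y - S' y = 0.
  apply: (vanish _) => i; rewrite innerC innerBr -hT -hS -innerBl.
  rewrite [X in inner X _]vanish ?inner0l ?conjC0// => l.
  by rewrite innerBl h subrr.
apply/funext => x; apply: inner_inj => y.
rewrite innerC hT [RHS]innerC hS; congr (_ ^*).
by congr (inner x _); apply/eqP; rewrite -subr_eq0 hTS.
Qed.

Section Ultra.
Context {I : Type} (U : set_system I) {UU : UltraFilter U}.

Section Operator.
Context (T : I -> H -> H) (M : C) (M0 : 0 <= M)
  (linT : forall n, linear (T n)) (bT : forall n x, `|T n x| <= M * `|x|).

(** The images of each [e k] stay in a span independent of [n], so they converge, and with them the
    images of finite combinations. The uniform bound extends this to all vectors by a Cauchy
    argument. *)
Lemma banded_strong_cvg (e : nat -> H) (f : nat -> nat) :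
  orthonormal_seq e -> complete_seq e ->
  (forall n k, in_span e (f k) (T n (e k))) ->
  exists Too : H -> H, forall x, (fun n => T n x) @ U --> Too x.
Proof.
move=> oe ce hf.
have /choice[y hy] (k : nat) : exists y : H, (fun n => T n (e k)) @ U --> y.
  by apply: (@ultra_in_span_cvg _ _ _ U _ e (f k) _ (M * `|e k|)) => //; apply: nearW.
suff h x : cvg ((fun n => T n x) @ U) by exists (fun x => lim ((fun n => T n x) @ U)).
apply/cauchy_cvgP; apply: cauchy_exP => d d0.
have M1 : 0 < M + 1 by rewrite ltr_wpDl.
have [m hm] : exists m, `|x - fourier_sum e e m x| < d / 2 / (M + 1).
  have h := frame_op_cvg x oe oe; rewrite ce in h.
  have h2 : 0 < d / 2 / (M + 1) by rewrite !divr_gt0.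
  near \oo => m; exists m; near: m; exact: cvgr_dist_lt.
have hs : (fun n => T n (fourier_sum e e m x)) @ U -->
    \sum_(0 <= k < m) inner x (e k) *: y k.
  rewrite (_ : (fun n => _) = fun n => \sum_(0 <= k < m) inner x (e k) *: T n (e k)); last first.
    apply/funext => n; rewrite (lin_sum (linT n)); apply: eq_bigr => k _.
    by rewrite (linZ (linT n)).
  apply: (cvg_big (op := +%R)) => [|k _]; first exact: add_continuous.
  by apply: cvgZl_tmp; exact: hy.
exists (\sum_(0 <= k < m) inner x (e k) *: y k).
have d2 : 0 < d / 2 by rewrite divr_gt0.
have : \forall n \near U, `|\sum_(0 <= k < m) inner x (e k) *: y k
   - T n (fourier_sum e e m x)| < d / 2 by exact: cvgr_dist_lt.
apply: filterS => n hn /=; rewrite -ball_normE/=.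
set s := fourier_sum _ _ _ _ in hn hm.
rewrite -[T n x](subrK (T n s)) opprD addrCA addrC (le_lt_trans (ler_normD _ _))//.
rewrite [d]splitr ltrD// -normrN opprK -(linB (linT n)) (le_lt_trans (bT _ _))//.
by rewrite (@le_lt_trans _ _ ((M + 1) * `|x - s|)) ?ler_wpM2r ?lerDl// mulrC -ltr_pdivlMr.
Unshelve. all: by end_near. Qed.

Context (Too : H -> H) (hT : forall x, (fun n => T n x) @ U --> Too x).

Lemma strong_limit_linear : linear Too.
Proof.
move=> a x y; apply: (vector_cvg_unique (@hT (a *: x + y))).
rewrite (_ : (fun n => _) = fun n => a *: T n x + T n y); last first.
  by apply/funext => n; rewrite linT.
by apply: cvgD; [apply: cvgZl_tmp|]; exact: hT.
Qed.

Lemma strong_limit_bound x : `|Too x| <= M * `|x|.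
Proof.
rewrite real_leNgt ?normr_real ?ger0_real ?mulr_ge0//; apply/negP => h.
have d0 : 0 < `|Too x| - M * `|x| by rewrite subr_gt0.
near U => n.
have : `|Too x - T n x| < `|Too x| - M * `|x|.
  by near: n; exact: cvgr_dist_lt.
rewrite ltrBrDr => hn.
have : `|Too x| < `|Too x|.
  rewrite (le_lt_trans _ hn)// -{1}[Too x](subrK (T n x)).
  by rewrite (le_trans (ler_normD _ _))// lerD2l.
by rewrite ltxx.
Unshelve. all: by end_near. Qed.

Lemma strong_limit_adj : (forall n, is_adjoint (T n) (T n)) -> is_adjoint Too Too.
Proof.
move=> hA x y; apply: (scalar_cvg_unique (cvg_innerl y (@hT x))).
rewrite (_ : (fun n => _) = fun n => inner x (T n y)); last first.
  by apply/funext => n; rewrite hA.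
exact: cvg_innerr.
Qed.

Lemma strong_limit_self_adjoint :
  (forall n, is_adjoint (T n) (T n)) -> self_adjoint Too.
Proof.
move=> hA; split; last exact/adjoint_eq/strong_limit_adj.
exact: bounded_operator_intro strong_limit_linear strong_limit_bound.
Qed.
End Operator.

Context {g : nat}.
Context (Z : I -> 'I_g -> H -> H) (M : C) (M0 : 0 <= M)
  (linZn : forall n j, linear (Z n j)) (bZ : forall n, tuple_bound M (Z n))
  (Zoo : 'I_g -> H -> H) (hZ : forall j x, (fun n => Z n j x) @ U --> Zoo j x).

(** Products are continuous for strong convergence on bounded sets: each letter is one use of
    [cvg_apply]. *)
Lemma seq_eval_cvg s (v : I -> H) w : v @ U --> w ->
  (fun n => seq_eval s (Z n) (v n)) @ U --> seq_eval s Zoo w.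
Proof.
move=> hv; elim: s => //= j s IH.
apply: (@cvg_apply _ _ _ U _ (fun n => Z n j) (Zoo j) _ _ M) => // n; exact: bZ.
Qed.

Lemma free_eval_cvg (p : free_poly R g) (v : I -> H) w : v @ U --> w ->
  (fun n => free_eval p (Z n) (v n)) @ U --> free_eval p Zoo w.
Proof.
move=> hv; rewrite free_evalE.
rewrite (_ : (fun n => _) = fun n =>
  \sum_(m <- msupp p) mcoeff m p *: seq_eval m (Z n) (v n)); last exact/funext.
apply: (cvg_big (op := +%R)) => [|k _]; first exact: add_continuous.
by apply: cvgZl_tmp; exact: seq_eval_cvg.
Qed.

Lemma sot_closed_limit (K : set ('I_g -> H -> H)) : sot_closed K ->
  (forall n, K (Z n)) -> sa_tuple Zoo -> K Zoo.
Proof.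
move=> Kc KZ saZ; apply: Kc; split=> // B nB.
have h : (Z : I -> {ptws 'I_g -> {ptws H -> H}}) @ U --> (Zoo : {ptws 'I_g -> {ptws H -> H}}).
  by apply: ptws_cvg => j; apply: ptws_cvg => x; exact: hZ.
have UB : U (Z @^-1` B) by exact: h.
by near U => n; exists (Z n); split=> //; near: n.
Unshelve. all: by end_near. Qed.

End Ultra.
End StrongLimits.

(** * Banded models of Gamma-pairs *)

Section GammaConvex.
Context {R : realType} {H : hilbertType R}.
Local Notation C := R[i].
Context {g r : nat} (Gamma : 'I_r -> free_poly R g).

Lemma sa_tuple_adj (X : 'I_g -> H -> H) : sa_tuple X ->
  forall j, is_adjoint (X j) (X j).
Proof. by move=> saX j; exact/self_adjoint_is_adjoint/saX. Qed.

Lemma frame_op_in_span (e b : nat -> H) n x : orthonormal_seq e ->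
  orthonormal_seq b -> in_span b n x -> in_span e n (frame_op b e x).
Proof.
move=> oe ob hx; rewrite /in_span [in LHS]hx /fourier_sum.
rewrite (lin_sum (frame_op_linear ob oe)); apply: eq_bigr => k _.
by rewrite (linZ (frame_op_linear ob oe)) frame_op_seq// inner_frame_op.
Qed.

(** Interleaving with period [g.+1] absorbs [X j (b k)] and [v k] at positions that depend on [j],
    [k] and [g] alone. The band is therefore the same for all [X] and [v]. *)
Lemma krylov_basis (X : 'I_g -> H -> H) (v : nat -> H) : infinite_dimensional H ->
  exists b, [/\ orthonormal_seq b,
    forall (j : 'I_g) k, in_span b (k * g.+1 + j).+2 (X j (b k))
  & forall k, in_span b (k * g.+1 + g).+2 (v k)].
Proof.
move=> infH.
(* With [j < g.+1], step [(k * g.+1 + j).+1] of Gram-Schmidt absorbs [X j (b k)],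
   or [v k] if [j = g]; [b k] is known by then. *)
pose T (s : seq H) := let m := (size s).-1 in
  if insub (m %% g.+1)%N is Some j then X j (nth 0 s (m %/ g.+1)%N)
  else v (m %/ g.+1)%N.
have [b ob hb] := gram_schmidt T infH.
have divE k a : (a < g.+1)%N -> ((k * g.+1 + a) %/ g.+1 = k)%N.
  by move=> ha; rewrite divnMDl// divn_small// addn0.
have modE k a : (a < g.+1)%N -> ((k * g.+1 + a) %% g.+1 = a)%N.
  by move=> ha; rewrite modnMDl modn_small.
exists b; split=> // [j k|k].
- have jg : (j < g.+1)%N by rewrite ltnW// ltnS.
  have := hb (k * g.+1 + j).+1; rewrite /T size_mkseq /= modE// divE//.
  by rewrite valK nth_mkseq// ltnS; nia.
- have := hb (k * g.+1 + g).+1; rewrite /T size_mkseq /= modE// divE//.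
  by rewrite insubF ?ltnn.
Qed.

Context (K : set ('I_g -> H -> H)) (Ksa : K `<=` sa_tuple)
  (Kcompress : forall X (V : H -> H), K X -> Gamma_pair Gamma X V -> K (compress V X)).

(** The isometry [W : e k |-> b k] has a range reducing [X] and containing the [v k]. It intertwines
    [X] with its compression [Z], so it forms a [Gamma]-pair with [X], and pulling the [v k] back
    along [W] keeps all inner products. *)
Lemma banded_model (e : nat -> H) X (v : nat -> H) : infinite_dimensional H ->
  orthonormal_seq e -> complete_seq e -> K X ->
  exists Z w, [/\ K Z,
    forall (j : 'I_g) k, in_span e (k * g.+1 + j).+2 (Z j (e k)),
    forall k, in_span e (k * g.+1 + g).+2 (w k),
    forall i l, inner (w i) (w l) = inner (v i) (v l)
  & forall k i l, inner (Gamma_eval Gamma Z k (w i)) (w l) =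
                  inner (Gamma_eval Gamma X k (v i)) (v l)].
Proof.
move=> infH oe ce KX.
have [b [ob bX bv]] := krylov_basis X v infH.
pose W := frame_op e b; pose W' := frame_op b e.
have linW : linear W by exact: frame_op_linear.
have isoW : linear_isometry W by exact: frame_op_isometry.
have adjW x y : inner (W x) y = inner x (W' y) by exact: frame_op_adj.
have adjW' x y : inner (W' x) y = inner x (W y) by exact: frame_op_adj.
have W'W x : W' (W x) = x by rewrite /W' /W frame_op_comp// ce.
have WW' x n : in_span b n x -> W (W' x) = x.
  by move=> hx; rewrite /W /W' frame_op_comp// (in_span_frame_op ob hx).
have aX := sa_tuple_adj (Ksa KX).
have aW : adjoint W = W' by exact: adjoint_eq.
pose Z j x := W' (X j (W x)).
have ZE : compress W X = Z by apply/funext => j; rewrite /compress aW.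
(* Both sides have adjoints, so matrix coefficients decide. They agree because [X j (b i)] lies in a
   finite span of [b], where [W] after [W'] is the identity. *)
have XW j x : X j (W x) = W (Z j x).
  suff E : (fun x => X j (W x)) = (fun x => W (W' (X j (W x)))).
    exact: (congr1 (@^~ x) E).
  apply: (@matrix_coef_inj _ _ e _ (fun y => W' (X j y)) _
    (fun y => W' (X j (W (W' y))))) => //.
  - by move=> y z; rewrite aX adjW.
  - by move=> y z; rewrite adjW adjW' aX adjW.
  - by move=> i l; rewrite /W frame_op_seq// -/W (WW' _ _ (bX j i)).
have GW k x : Gamma_eval Gamma X k (W x) = W (Gamma_eval Gamma Z k x).
  exact: free_eval_intertwine.
exists Z, (fun k => W' (v k)); split.
- rewrite -ZE; apply: Kcompress => //; split=> //; first exact: Ksa.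
  rewrite ZE; apply/funext => k; apply/funext => x.
  by rewrite /compress aW /= GW W'W.
- move=> j k; rewrite /Z; apply: frame_op_in_span => //.
  by rewrite /W frame_op_seq.
- by move=> k; exact: frame_op_in_span.
- by move=> i l; rewrite adjW' (WW' _ _ (bv l)).
- by move=> k i l; rewrite -adjW -GW (WW' _ _ (bv i)).
Qed.

Context (le_gr : (g <= r)%N)
    (Gamma_sym : forall k, free_symmetric (Gamma k))
    (Gamma_var : forall j : 'I_g, Gamma (widen_ord le_gr j) = free_var j).

Lemma Gamma_eval_widen (X : 'I_g -> H -> H) j : Gamma_eval Gamma X (widen_ord le_gr j) = X j.
Proof. by apply/funext => x; rewrite /Gamma_eval Gamma_var free_eval_var. Qed.

Definition gram_close (e : nat -> H) (Y : 'I_g -> H -> H) N (eps : C) X (v : nat -> H) :=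
  forall i l, (i < N)%N -> (l < N)%N ->
    `|inner (v i) (v l) - inner (e i) (e l)| <= eps /\
    forall k, `|inner (Gamma_eval Gamma X k (v i)) (v l)
                - inner (Gamma_eval Gamma Y k (e i)) (e l)| <= eps.

Context (M : C) (M1 : 1 <= M) (KM : forall X, K X -> tuple_bound M X)
  (Kclosed : sot_closed K).

Lemma gram_limit (e : nat -> H) (Y : 'I_g -> H -> H) :
  infinite_dimensional H -> orthonormal_seq e -> complete_seq e -> sa_tuple Y ->
  (forall n, exists X v, K X /\ gram_close e Y n.+1 n.+1%:R^-1 X v) -> K Y.
Proof.
move=> infH oe ce saY happrox.
have M0 : 0 <= M by rewrite (le_trans _ M1).
have /choice[Zv hZv] n : exists Zw : ('I_g -> H -> H) * (nat -> H),
   [/\ K Zw.1, forall (j : 'I_g) k, in_span e (k * g.+1 + j).+2 (Zw.1 j (e k)),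
    forall k, in_span e (k * g.+1 + g).+2 (Zw.2 k)
    & gram_close e Y n.+1 n.+1%:R^-1 Zw.1 Zw.2].
  have [X [v [KX cX]]] := happrox n.
  have [Z [w [h1 h2 h3 h4 h5]]] := banded_model v infH oe ce KX.
  exists (Z, w); split=> // i l hi hl; rewrite h4; split; first by have [] := cX _ _ hi hl.
  by move=> k; rewrite h5; have [_] := cX _ _ hi hl.
pose Z n := (Zv n).1; pose v n := (Zv n).2.
have KZ n : K (Z n) by have [] := hZv n.
have aZ n := sa_tuple_adj (Ksa (KZ n)).
have lZ n j : linear (Z n j) by have [[]] := Ksa (KZ n) j.
have bZ n : tuple_bound M (Z n) by exact: KM.
(* An ultrafilter refining convergence to infinity yields all the limits below at once, without
   diagonal extraction. *)
have [U [UU sU]] := ultraFilterLemma (F := \oo%classic) _.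
have close0 (a : nat -> C) (b : C) n0 :
    (forall n, (n0 <= n)%N -> `|a n - b| <= n.+1%:R^-1) ->
    (a : nat -> C^o) @ U --> (b : C^o).
  move=> hab.
  suff : (a : nat -> C^o) @ \oo --> (b : C^o) by apply: cvg_trans; exact: cvg_app.
  apply/cvgrPdist_lt => d d0.
  have dE : d = (complex.Re d)%:C by rewrite RRe_real// gtr0_real.
  have rd0 : 0 < complex.Re d by move: d0; rewrite dE ltcR.
  near=> n; rewrite distrC (le_lt_trans (hab _ _))//; first by near: n; exists n0.
  rewrite dE (_ : n.+1%:R^-1 = (n.+1%:R^-1 : R)%:C) ?ltcR; last first.
    by rewrite rmorphV ?unitfE// rmorph_nat.
  by near: n; exact: (near_infty_natSinv_lt (PosNum rd0)).
(* For [n >= i] the squared norm is within 1 of [<e i, e i> = 1], hence at most [2 <= 2^2]. *)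
have vb i : \forall n \near U, `|v n i| <= 2.
  apply: sU; exists i => // n /= ni.
  have [_ _ _ /(_ i i ni ni)[]] := hZv n; rewrite -/(v n) oe eqxx => h _.
  rewrite -ler_sqr ?nnegrE// sqr_norm_inner -[inner _ _](subrK 1).
  have h1 : `|inner (v n i) (v n i) - 1| <= 1.
    by rewrite (le_trans h)// invf_le1 ?ler1n.
  rewrite (le_trans (real_ler_norm _))//.
    by rewrite subrK ger0_real// inner_ge0.
  rewrite (le_trans (ler_normD _ _))// normr1 (le_trans (lerD h1 (lexx _)))//.
  by rewrite -natrX -(natrD _ 1 1) ler_nat.
have /choice[w hw] i : exists w : H, (fun n => v n i) @ U --> w.
  apply: (@ultra_in_span_cvg _ _ _ U _ e (i * g.+1 + g).+2 _ 2) => // n.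
  by have [_ _] := hZv n.
have /choice[Zoo hZ] j : exists T : H -> H, forall x, (fun n => Z n j x) @ U --> T x.
  apply: (@banded_strong_cvg _ _ _ U _ (fun n => Z n j) M M0 _ _ e
    (fun k => (k * g.+1 + j).+2)) => //.
    by move=> n; exact: bZ.
  by move=> n k; have [_ h _ _] := hZv n; exact: h.
have ow : orthonormal_seq w.
  move=> i l; apply: (scalar_cvg_unique (cvg_inner (hw i) (hw l))).
  apply: (close0 _ _ (maxn i l)) => n; rewrite geq_max => /andP[ni nl].
  by have [_ _ _ /(_ i l ni nl)[]] := hZv n; rewrite oe.
have saZ : sa_tuple Zoo.
  move=> j; apply: (@strong_limit_self_adjoint _ _ _ U _ (fun n => Z n j) M M0) => //.
  by move=> n; exact: bZ.
have KZoo : K Zoo by apply: (sot_closed_limit (U := U) hZ).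
pose V := frame_op e w.
have aV : is_adjoint V (frame_op w e) by move=> x y; exact: frame_op_adj.
have GE : compress V (Gamma_eval Gamma Zoo) = Gamma_eval Gamma Y.
  apply/funext => k; rewrite /compress (adjoint_eq aV).
  have aG : is_adjoint (Gamma_eval Gamma Zoo k) (Gamma_eval Gamma Zoo k).
    exact/free_eval_adj/sa_tuple_adj.
  apply: (@matrix_coef_inj _ _ e _ (frame_op w e \o Gamma_eval Gamma Zoo k \o V)
     _ (Gamma_eval Gamma Y k)) => //.
  - by move=> x y /=; rewrite frame_op_adj// aG aV.
  - exact/free_eval_adj/sa_tuple_adj.
  move=> i l /=; rewrite frame_op_adj// /V !frame_op_seq//.
  have h : (fun n => Gamma_eval Gamma (Z n) k (v n i)) @ U --> Gamma_eval Gamma Zoo k (w i).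
    by apply: (free_eval_cvg M0 lZ bZ hZ); exact: hw.
  (* The same scalars converge to the coefficients of [gamma_k] at [Zoo] along [w] by strong
     convergence, and to those at [Y] along [e] by approximation. *)
  apply: (scalar_cvg_unique (cvg_inner h (hw l))).
  apply: (close0 _ _ (maxn i l)) => n; rewrite geq_max => /andP[ni nl].
  by have [_ _ _ /(_ i l ni nl)[_]] := hZv n; apply.
(* The coordinates occur among the [gamma_k], so [GE] contains this equation, which in turn makes
   [GE] the [Gamma]-pair condition. *)
have YE : compress V Zoo = Y.
  apply/funext => j; have /(congr1 (fun F => F (widen_ord le_gr j))) := GE.
  by rewrite /compress !Gamma_eval_widen.
rewrite -YE; apply: Kcompress => //; split=> //; first exact: frame_op_isometry.
by rewrite YE.
Unshelve. all: by end_near. Qed.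

End GammaConvex.

(** * Separation in finite dimension *)

Section ApproximateSeparation.
Context {R : realType} {F : finType}.
Local Notation C := R[i].
Implicit Types (a b c p q : F -> C) (t : R).

(** The real inner product that makes [F -> C] a Euclidean space over [R]. *)
Definition re_dot a b : R := \sum_f complex.Re ((a f)^* * b f).

Lemma re_dotDr a b c t :
  re_dot c (fun f => a f + t%:C * b f) = re_dot c a + t * re_dot c b.
Proof.
rewrite /re_dot mulr_sumr -big_split; apply: eq_bigr => f _ /=.
by case: (a f) (b f) (c f) => [? ?] [? ?] [? ?] /=; ring.
Qed.

Lemma re_dotC a b : re_dot a b = re_dot b a.
Proof.
apply: eq_bigr => f _ /=.
by case: (a f) (b f) => [? ?] [? ?] /=; ring.
Qed.

Lemma re_dot_sq a : re_dot a a = \sum_f complex.Re (`|a f| ^+ 2 : C).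
Proof. by apply: eq_bigr => f _; rewrite normCK mulrC. Qed.

Lemma re_dot_ge0 a : 0 <= re_dot a a.
Proof.
rewrite re_dot_sq; apply: sumr_ge0 => f _.
by have := exprn_ge0 2 (normr_ge0 (a f)); rewrite lecE => /andP[].
Qed.

Lemma re_dot_expand a b t :
  re_dot (fun f => a f + t%:C * b f) (fun f => a f + t%:C * b f) =
  re_dot a a + 2 * t * re_dot a b + t ^+ 2 * re_dot b b.
Proof. by rewrite re_dotDr !(re_dotC (fun f => _ + _)) !re_dotDr (re_dotC b a); ring. Qed.

(* The nearest point [c] to [p] in the cone [S] need not exist, but a near
   minimiser of the distance satisfies the separation inequalities up to an
   error which is uniform on bounded parts of [S]. *)
Lemma approximate_separation (S : set (F -> C)) p (d B delta : R) :
  S !=set0 ->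
  (forall a b t, S a -> S b -> 0 <= t -> S (fun f => a f + t%:C * b f)) ->
  (forall a t, S a -> 0 <= t -> S (fun f => t%:C * a f)) ->
  0 < d -> (forall a, S a -> d <= re_dot (fun f => a f - p f) (fun f => a f - p f)) ->
  0 <= B -> 0 < delta ->
  exists c, let q f := c f - p f in
  [/\ S c, forall a beta, S a -> 0 < beta -> re_dot a a <= B * beta ^+ 2 ->
     - (delta * beta) <= re_dot q a & re_dot q p <= delta - d].
Proof.
move=> [a0 Sa0] Sadd Sscale d0 dS B0 delta0.
pose dist a := re_dot (fun f => a f - p f) (fun f => a f - p f).
pose m := inf [set dist a | a in S].
have hi : has_inf [set dist a | a in S].
  split; first by exists (dist a0); exists a0.
  by exists d => _ [a Sa <-]; exact: dS.
have mle a : S a -> m <= dist a.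
  by move=> Sa; apply: ge_inf; [case: hi | exists a].
have dm : d <= m.
  by apply: lb_le_inf; [case: hi | move=> _ [a Sa <-]; exact: dS].
(* A bound for [re_dot c c]: as [c = q + p], it is at most [2 |q|^2 + 2 |p|^2], and
   [|q|^2 < m + t^2 <= m + 1]. *)
pose B2 := 2 * re_dot p p + 2 * (m + 1).
have pp0 := re_dot_ge0 p.
have B20 : 0 <= B2 by rewrite /B2; lra.
(* Here [t] is both a step length and, squared, the defect of minimality of [c]. The two quotients
   serve the comparisons with [c + (t / beta) a] and with [(1 - t) c]; the latter stays in the cone
   as [t <= 1]. *)
pose t := Num.min 1 (Num.min (delta / (1 + B)) (delta / (1 + B2))).
have t0 : 0 < t by rewrite !lt_min ltr01 !divr_gt0//; lra.
have t1 : t <= 1 by rewrite ge_min lexx.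
have tB : t * (1 + B) <= delta.
  rewrite -ler_pdivlMr; last by lra.
  by rewrite /t !ge_min lexx /= orbT.
have tB2 : t * (1 + B2) <= delta.
  rewrite -ler_pdivlMr; last by lra.
  by rewrite /t !ge_min lexx /= !orbT.
have [_ [c Sc <-] hc] := inf_adherent (exprn_gt0 2 t0) hi.
exists c; pose q f := c f - p f; rewrite /=; rewrite -/q -/m in hc *.
have distq : dist c = re_dot q q by [].
split=> //.
  move=> a beta Sa b0 hB.
  have s0 : 0 < t / beta by rewrite divr_gt0.
  have := mle _ (Sadd c a _ Sc Sa (ltW s0)).
  have -> : dist (fun f => c f + (t / beta)%:C * a f) =
    re_dot q q + 2 * (t / beta) * re_dot q a + (t / beta) ^+ 2 * re_dot a a.
    rewrite -re_dot_expand; congr re_dot; apply/funext => f; rewrite /q; ring.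
  rewrite distq in hc => h.
  have h2 : (t / beta) ^+ 2 * re_dot a a <= t ^+ 2 * B.
    rewrite expr_div_n mulrAC -mulrA ler_wpM2l ?sqr_ge0//.
    by rewrite ler_pdivrMr ?exprn_gt0.
  have h3 : 0 < 2 * (t / beta) * re_dot q a + t ^+ 2 * (1 + B) by lra.
  have h4 : 0 < 2 * re_dot q a + t * beta * (1 + B).
    have -> : 2 * re_dot q a + t * beta * (1 + B) =
      (2 * (t / beta) * re_dot q a + t ^+ 2 * (1 + B)) * (beta / t).
      by field; lra.
    by rewrite mulr_gt0// divr_gt0.
  have h5 : t * beta * (1 + B) <= delta * beta by rewrite mulrAC ler_pM2r.
  have h6 : 0 < delta * beta by rewrite mulr_gt0.
  lra.
(* Since [|q|^2 >= m >= d], it remains to show [re_dot q c <= delta], which comes from comparing [c]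
   with [(1 - t) c]. *)
have hqc : re_dot q p = re_dot q c - re_dot q q.
  have -> : re_dot q p = re_dot q (fun f => c f + (-1)%:C * q f).
    by congr re_dot; apply/funext => f; rewrite /q rmorphN1; ring.
  by rewrite re_dotDr; ring.
have h := mle _ (Sscale c (1 - t) Sc _).
have cB : re_dot c c <= B2.
  have := re_dot_ge0 (fun f => q f + (-1)%:C * p f).
  rewrite re_dot_expand => h1.
  have -> : re_dot c c = re_dot (fun f => q f + 1%:C * p f) (fun f => q f + 1%:C * p f).
    by congr re_dot; apply/funext => f; rewrite /q rmorph1; ring.
  rewrite re_dot_expand /B2; rewrite distq in hc.
  have : t ^+ 2 <= 1 by rewrite expr_le1// ltW.
  lra.
have {}h : m <= dist (fun f => (1 - t)%:C * c f) by apply: h; lra.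
have E : dist (fun f => (1 - t)%:C * c f) =
    re_dot q q + 2 * (- t) * re_dot q c + (- t) ^+ 2 * re_dot c c.
  rewrite -re_dot_expand; congr re_dot; apply/funext => f;
  by rewrite /q rmorphB rmorphN rmorph1; ring.
have qq : m <= re_dot q q by rewrite -distq; exact: mle.
rewrite E distq in h hc.
have h2 : t ^+ 2 * re_dot c c <= t ^+ 2 * B2 by rewrite ler_wpM2l// sqr_ge0.
have h3 : re_dot q c * t <= delta * t.
  have : t ^+ 2 * (1 + B2) <= delta * t by rewrite expr2 -mulrA mulrC ler_pM2r.
  nra.
have : re_dot q c <= delta by rewrite -(ler_pM2r t0).
rewrite hqc; lra.
Qed.

End ApproximateSeparation.

(** * Congruence of positive definite matrices to the identity *)

Section PositiveDefinite.
Context {R : realType} {N : nat}.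
Local Notation C := R[i].
Local Open Scope sesquilinear_scope.

(** Diagonalise [P] by a unitary [U] and rescale by the inverse square roots of the eigenvalues; the
    [j]-th eigenvalue is the form at row [j] of [U], hence positive. *)
Lemma posdef_congruent1 (P : 'M[C]_N) : P \is hermsymmx ->
  (forall c : 'rV[C]_N, c != 0 -> 0 < (c *m P *m c ^t conjC) 0 0) ->
  exists2 T : 'M[C]_N, T \in unitmx & T ^t conjC *m P *m T = 1%:M.
Proof.
move=> hP pos.
have /orthomx_spectralP PE := hermitian_normalmx hP.
set U := spectralmx P in PE; set D := spectral_diag P in PE.
have uU : U \is unitarymx by exact: spectral_unitarymx.
have unU : U \in unitmx by exact: spectral_unit.
have UV : invmx U = U ^t conjC by exact: invmx_unitary.
have DE : diag_mx D = U *m P *m U ^t conjC.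
  by rewrite PE -UV !mulmxA mulmxV// mul1mx -mulmxA mulmxV// mulmx1.
have Dpos j : 0 < D 0 j.
  have : 0 < (row j U *m P *m (row j U) ^t conjC) 0 0.
    apply: pos; apply/eqP => r0.
    have : row j (U *m invmx U) = 0 by rewrite row_mul r0 mul0mx.
    rewrite mulmxV// => /rowP/(_ j); rewrite !mxE eqxx => /eqP.
    by rewrite oner_eq0.
  suff -> : (row j U *m P *m (row j U) ^t conjC) 0 0 = D 0 j by [].
  have -> : D 0 j = (diag_mx D) j j by rewrite mxE eqxx.
  rewrite DE -row_mul !mxE; apply: eq_bigr => k _.
  by rewrite !mxE.
pose E : 'M[C]_N := diag_mx (\row_j (sqrtC (D 0 j))^-1).
have Er : E ^t conjC = E.
  rewrite /E tr_diag_mx map_diag_mx; congr diag_mx; apply/rowP => j; rewrite !mxE.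
  by apply: conj_Creal; rewrite ger0_real// invr_ge0 sqrtC_ge0 ltW.
have EDE : E *m diag_mx D *m E = 1%:M.
  apply/matrixP => i j; rewrite /E mul_diag_mx mul_mx_diag !mxE.
  case: eqVneq => [<-|_]; rewrite ?mulr0n ?mulr0 ?mul0r// mulr1n.
  rewrite -[X in _ * X * _]sqrtCK expr2 mulrA mulVf; last first.
    by rewrite sqrtC_eq0 gt_eqF.
  by rewrite mul1r mulfV// sqrtC_eq0 gt_eqF.
have TE : (U ^t conjC *m E) ^t conjC *m P *m (U ^t conjC *m E) = 1%:M.
  rewrite trmx_mul map_mxM Er trmxCK.
  rewrite -EDE DE !mulmxA//.
exists (U ^t conjC *m E) => //.
by have [] := mulmx1_unit TE.
Qed.

End PositiveDefinite.

(** * Direct sums and pencils *)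

Section DirectSum.
Context {R : realType} {H : hilbertType R}.

Context {g : nat}.

(** The isometries [E] and [E'] send the basis to its even and odd members, so their ranges split
    [H] and realise the direct sum of two copies inside [H]. *)
Lemma direct_sum_model (K : set ('I_g -> H -> H)) (e : nat -> H) X X' :
  orthonormal_seq e -> complete_seq e -> free_set K -> K X -> K X' ->
  exists Z E E', [/\ K Z, linear E, linear E' &
    [/\ forall x y, inner (E x) (E y) = inner x y,
    forall x y, inner (E' x) (E' y) = inner x y,
    forall x y, inner (E x) (E' y) = 0,
    forall j x, Z j (E x) = E (X j x) & forall j x, Z j (E' x) = E' (X' j x)]].
Proof.
move=> oe ce [Ksa _ Kds] KX KX'.
have lX j : linear (X j) by have [[]] := Ksa _ KX j.
have lX' j : linear (X' j) by have [[]] := Ksa _ KX' j.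
pose e0 k := e k.*2; pose e1 k := e k.*2.+1.
have oe0 : orthonormal_seq e0.
  by move=> i j; rewrite /e0 oe; congr ((_ : bool)%:R); apply/eqP/eqP => [|->//]; lia.
have oe1 : orthonormal_seq e1.
  by move=> i j; rewrite /e1 oe; congr ((_ : bool)%:R); apply/eqP/eqP => [|->//]; lia.
have e01 i j : inner (e0 i) (e1 j) = 0.
  by rewrite /e0 /e1 oe; case: eqP => //; lia.
pose E := frame_op e e0; pose F := frame_op e0 e.
pose E' := frame_op e e1; pose F' := frame_op e1 e.
have lE : linear E by exact: frame_op_linear.
have lE' : linear E' by exact: frame_op_linear.
have FE x : F (E x) = x by rewrite /F /E frame_op_comp// ce.
have FE' x : F' (E' x) = x by rewrite /F' /E' frame_op_comp// ce.
have adjE x y : inner (E x) y = inner x (F y) by exact: frame_op_adj.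
have adjE' x y : inner (E' x) y = inner x (F' y) by exact: frame_op_adj.
have adjF x y : inner (F x) y = inner x (E y) by exact: frame_op_adj.
have adjF' x y : inner (F' x) y = inner x (E' y) by exact: frame_op_adj.
have F0 x : F (E' x) = 0.
  by apply: frame_op_orth => // k; rewrite adjE' /F' frame_op_orth ?inner0r.
have F'0 x : F' (E x) = 0.
  apply: frame_op_orth => // k; rewrite adjE /F frame_op_orth ?inner0r// => l.
  by rewrite innerC e01 conjC0.
have lF : linear F by exact: frame_op_linear.
have lF' : linear F' by exact: frame_op_linear.
have sumE y : E (F y) + E' (F' y) = y.
  suff h : (fun y => E (F y) + E' (F' y)) = id by exact: (congr1 (@^~ y) h).
  apply: (@matrix_coef_inj _ _ e _ (fun y => E (F y) + E' (F' y)) _ id) => //.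
    by move=> x z; rewrite innerDl innerDr adjE adjE' adjF adjF'.
  move=> i l /=; congr (inner _ _); rewrite -(odd_double_half i).
  case: (odd i); rewrite ?add1n ?add0n.
    rewrite /E' /F' -/(e1 i./2) frame_op_seq// frame_op_seq//.
    rewrite /F frame_op_orth ?(lin0 lE) ?add0r// => k.
    by rewrite innerC e01 conjC0.
  rewrite /E /F -/(e0 i./2) frame_op_seq// frame_op_seq//.
  by rewrite /F' frame_op_orth ?(lin0 lE') ?addr0.
pose XX (i : 'I_2) := if i == ord0 then X else X'.
pose Phi (u : 'I_2 -> H) := E (u ord0) + E' (u ord_max).
pose Z j y := Phi (fun i => XX i j (if i == ord0 then F y else F' y)).
have PhiE x y : Phi (fun i => if i == ord0 then x else y) = E x + E' y by [].
exists Z, E, E'; split=> //.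
- apply: (Kds 2%N XX Phi).
  + by move=> i; rewrite /XX; case: ifP.
  + split.
    * move=> a u v; rewrite /Phi /= lE lE' scalerDr.
      by rewrite addrACA.
    * move=> u v; rewrite /Phi innerDl !innerDr /sum_inner !big_ord_recl big_ord0.
      rewrite !adjE !adjE' FE FE' F0 F'0 !inner0r addr0 add0r addr0.
      by congr (_ + inner (u _) (v _)); exact/val_inj.
    * move=> y; exists (fun i => if i == ord0 then F y else F' y).
      by rewrite PhiE sumE.
  + move=> j u; rewrite /Z /Phi /= (linD lF) (linD lF') FE FE' F0 F'0.
    by rewrite addr0 add0r.
- split.
  + by move=> x y; rewrite adjE FE.
  + by move=> x y; rewrite adjE' FE'.
  + by move=> x y; rewrite adjE F0 inner0r.
  + by move=> j x; rewrite /Z /Phi /XX /= FE F'0 (lin0 (lX' j)) (lin0 lE') addr0.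
  + by move=> j x; rewrite /Z /Phi /XX /= FE' F0 (lin0 (lX j)) (lin0 lE) add0r.
Qed.

End DirectSum.

(** * Pencils as linear functionals of Gram matrices *)

Section PencilForms.
Context {R : realType} {H : hilbertType R}.
Local Notation C := R[i].
Local Open Scope sesquilinear_scope.
Context {g r : nat} (Gamma : 'I_r -> free_poly R g).
Implicit Types (X : 'I_g -> H -> H) (o : 'I_r.+1).

(** Index 0 stands for the constant polynomial 1, so that the constant term of a pencil is treated
    like the others. *)
Definition Gamma1_eval X o : H -> H :=
  if unlift ord0 o is Some k then Gamma_eval Gamma X k else idfun.

Lemma Gamma1_eval_linear X o : (forall j, linear (X j)) -> linear (Gamma1_eval X o).
Proof.
by move=> lX; rewrite /Gamma1_eval; case: unlift => [k|//]; exact: free_eval_linear.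
Qed.

Section Size.
Context {N : nat}.
Implicit Types (u : 'I_N -> H) (A : 'I_r.+1 -> 'M[C]_N).

Definition gram_mx X u o : 'M[C]_N :=
  \matrix_(m, i) inner (Gamma1_eval X o (u m)) (u i).

(** The quadratic form of a pencil, linear in the Gram matrices so that separation applies. The
    constant coefficient [A ord0] is arbitrary at this stage. *)
Definition pencil_form A X u : C := \sum_o \tr (A o *m gram_mx X u o).

Definition monic_family (A : 'I_r -> 'M[C]_N) o : 'M[C]_N :=
  if unlift ord0 o is Some k then A k else 1%:M.

Lemma sum_inner_pencil (A : 'I_r -> 'M[C]_N) X u :
  sum_inner (pencil_eval A Gamma X u) u = pencil_form (monic_family A) X u.
Proof.
rewrite /sum_inner /pencil_form /mxtrace exchange_big /=.
apply: eq_bigr => i _; rewrite big_ord_recl /pencil_eval innerDl; congr (_ + _).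
  rewrite /tensor_op inner_suml mxE; apply: eq_bigr => k _.
  by rewrite innerZl /gram_mx [in RHS]mxE /monic_family /Gamma1_eval !unlift_none.
rewrite inner_suml; apply: eq_bigr => k _.
rewrite /tensor_op inner_suml mxE; apply: eq_bigr => m _.
by rewrite innerZl /gram_mx [in RHS]mxE /monic_family /Gamma1_eval !liftK.
Qed.

(** The action of [T] tensored with the identity of [H]; on forms it amounts to a congruence of the
    coefficients. *)
Definition mx_act (T : 'M[C]_N) u : 'I_N -> H := fun m => \sum_a T m a *: u a.

Lemma mx_act1 u : mx_act 1%:M u = u.
Proof.
apply/funext => m; rewrite /mx_act (bigD1 m)//= mxE eqxx scale1r big1 ?addr0//.
by move=> a am; rewrite mxE eq_sym (negPf am) scale0r.
Qed.

Lemma mx_act_mul S T u : mx_act (S *m T) u = mx_act S (mx_act T u).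
Proof.
apply/funext => m; rewrite /mx_act.
under [RHS]eq_bigr do rewrite scaler_sumr.
rewrite exchange_big /=; apply: eq_bigr => a _; rewrite mxE scaler_suml.
by apply: eq_bigr => b _; rewrite scalerA.
Qed.

Lemma gram_mx_act T X u o : (forall j, linear (X j)) ->
  gram_mx X (mx_act T u) o = T *m gram_mx X u o *m T ^t conjC.
Proof.
move=> lX; apply/matrixP => m i; rewrite !mxE (lin_sum (Gamma1_eval_linear o lX)).
rewrite inner_sumr; apply: eq_bigr => b _; rewrite innerZr !mxE mulrC inner_suml.
congr (_ * _); apply: eq_bigr => a _.
by rewrite (linZ (Gamma1_eval_linear o lX)) innerZl mxE.
Qed.

Lemma pencil_form_congr T A X u : (forall j, linear (X j)) ->
  pencil_form (fun o => T ^t conjC *m A o *m T) X u = pencil_form A X (mx_act T u).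
Proof.
move=> lX; apply: eq_bigr => o _; rewrite gram_mx_act//.
by rewrite -!mulmxA mxtrace_mulC !mulmxA.
Qed.

Hypothesis Gamma_sym : forall k, free_symmetric (Gamma k).

Lemma Gamma1_eval_adj X o : sa_tuple X ->
  is_adjoint (Gamma1_eval X o) (Gamma1_eval X o).
Proof.
move=> saX; rewrite /Gamma1_eval; case: unlift => [k|//].
exact/free_eval_adj/sa_tuple_adj.
Qed.

Lemma gram_mx_herm X u o : sa_tuple X -> (gram_mx X u o) ^t conjC = gram_mx X u o.
Proof.
by move=> saX; apply/matrixP => m i; rewrite !mxE -innerC Gamma1_eval_adj.
Qed.

Lemma pencil_form_conj A X u : sa_tuple X -> (forall o, (A o) ^t conjC = A o) ->
  (pencil_form A X u)^* = pencil_form A X u.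
Proof.
move=> saX hA; rewrite /pencil_form rmorph_sum; apply: eq_bigr => o _.
have trJ (B : 'M[C]_N) : (\tr B)^* = \tr (B ^t conjC).
  by rewrite /mxtrace rmorph_sum; apply: eq_bigr => i _; rewrite !mxE.
apply: (etrans (trJ _)); rewrite trmx_mul map_mxM hA gram_mx_herm//.
exact: mxtrace_mulC.
Qed.

Lemma pencil_formD A B X u :
  pencil_form (fun o => A o + B o) X u = pencil_form A X u + pencil_form B X u.
Proof.
by rewrite /pencil_form -big_split; apply: eq_bigr => o _; rewrite mulmxDl linearD.
Qed.

Definition sq_size u : C := \sum_i `|u i| ^+ 2.

Lemma pencil_form_scalar (a : C) X u :
  pencil_form (fun o => if o == ord0 then a%:M else 0) X u = a * sq_size u.
Proof.
rewrite /pencil_form big_ord_recl eqxx big1 ?addr0; last first.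
  by move=> o _; rewrite mul0mx mxtrace0.
rewrite mul_scalar_mx mxtraceZ; congr (_ * _); apply: eq_bigr => i _.
by rewrite mxE /Gamma1_eval unlift_none sqr_norm_inner.
Qed.

Lemma sq_size_ge0 u : 0 <= sq_size u.
Proof. by apply: sumr_ge0 => i _; exact: exprn_ge0. Qed.

Lemma sq_size_norm u i : `|u i| ^+ 2 <= sq_size u.
Proof.
rewrite /sq_size (bigD1 i)//= lerDl; apply: sumr_ge0 => k _; exact: exprn_ge0.
Qed.

Lemma gram_mx_bound X u o (B : C) m i : 0 <= B ->
  (forall x, `|Gamma1_eval X o x| <= B * `|x|) ->
  `|gram_mx X u o m i| <= B * sq_size u.
Proof.
move=> B0 hB; rewrite mxE (le_trans (cauchy_schwarz _ _))//.
rewrite (@le_trans _ _ (B * `|u m| * `|u i|)) ?ler_wpM2r// -mulrA ler_wpM2l//.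
have h : 2 * (`|u m| * `|u i|) <= `|u m| ^+ 2 + `|u i| ^+ 2.
  rewrite -subr_ge0 (_ : _ - _ = (`|u m| - `|u i|) ^+ 2); last by ring.
  by rewrite real_exprn_even_ge0// rpredB// normr_real.
have h2 : 2 * (`|u m| * `|u i|) <= 2 * sq_size u.
  by rewrite (le_trans h)// mulr_natl mulr2n lerD// sq_size_norm.
by rewrite ler_pM2l in h2.
Qed.

(** All matrix entries form one vector, for which [re_dot] is the real part of the trace pairing. *)
Definition flat_gram (A : 'I_r.+1 -> 'M[C]_N) (f : 'I_r.+1 * 'I_N * 'I_N) : C :=
  A f.1.1 f.1.2 f.2.

Lemma re_dot_flat A B :
  re_dot (flat_gram A) (flat_gram B) = complex.Re (\sum_o \tr ((A o) ^t conjC *m B o)).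
Proof.
rewrite /re_dot.
have ReD : {morph (@complex.Re R) : x y / x + y >-> x + y} by case=> ? ? [].
rewrite -(big_morph _ ReD (erefl : complex.Re (0 : C) = 0)).
congr complex.Re.
rewrite -(pair_bigA _ (fun p i => (A p.1 p.2 i)^* * B p.1 p.2 i)) /=.
rewrite -(pair_bigA _ (fun o m => \sum_i (A o m i)^* * B o m i)) /=.
apply: eq_bigr => o _; rewrite exchange_big /=; apply: eq_bigr => i _.
by rewrite mxE; apply: eq_bigr => m _; rewrite !mxE.
Qed.

End Size.
End PencilForms.

(** * From the absence of a separating pencil to approximating points of [K] *)

Section Separation.
Context {R : realType} {H : hilbertType R}.
Local Notation C := R[i].
Local Open Scope sesquilinear_scope.
Context {g r : nat} (Gamma : 'I_r -> free_poly R g)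
  (Gamma_sym : forall k, free_symmetric (Gamma k))
  (Gamma0 : Gamma_eval Gamma (fun _ : 'I_g => (fun=> 0) : H -> H)
              = (fun=> fun=> 0))
  (K : set ('I_g -> H -> H)) (Kfree : free_set K) (K0 : K (fun=> fun=> 0))
  (M : C) (M0 : 0 <= M) (KM : forall X, K X -> tuple_bound M X)
  (e : nat -> H) (oe : orthonormal_seq e) (ce : complete_seq e).

Let Ksa : K `<=` sa_tuple. Proof. by case: Kfree. Qed.
Let Klin X (KX : K X) j : linear (X j). Proof. by have [[]] := Ksa KX j. Qed.

Lemma sqrt_re_complex (t : R) : 0 <= t ->
  (Num.sqrt t)%:C * ((Num.sqrt t)%:C : C)^* = t%:C.
Proof.
move=> t0; rewrite conj_Creal; last by rewrite complex_real.
by rewrite -rmorphM -expr2 sqr_sqrtr.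
Qed.

Lemma Re_sqr_norm_le (z : C) (b : R) : `|z| <= b%:C ->
  complex.Re (`|z| ^+ 2 : C) <= b ^+ 2.
Proof.
move=> zb; have : `|z| ^+ 2 <= (b ^+ 2)%:C.
  by rewrite rmorphXn lerXn2r ?nnegrE// (le_trans _ zb).
by rewrite lecE => /andP[].
Qed.

Lemma gram_mxZ N X (u : 'I_N -> H) (t : R) o : (forall j, linear (X j)) -> 0 <= t ->
  gram_mx Gamma X (fun i => (Num.sqrt t)%:C *: u i) o = t%:C *: gram_mx Gamma X u o.
Proof.
move=> lX t0; apply/matrixP => m i; rewrite !mxE.
rewrite (linZ (Gamma1_eval_linear _ o lX)) innerZl innerZr mulrA.
by rewrite sqrt_re_complex.
Qed.

Lemma Gamma1_eval_intertwine X Z (W : H -> H) o x : linear W ->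
  (forall j y, X j (W y) = W (Z j y)) ->
  Gamma1_eval Gamma X o (W x) = W (Gamma1_eval Gamma Z o x).
Proof.
move=> lW h; rewrite /Gamma1_eval; case: unlift => [k|//].
exact: free_eval_intertwine.
Qed.

(** Cross terms vanish in a direct sum, so Gram matrices add up, and scaling vectors by the square
    root of [t] multiplies them by [t]. Hence the Gram matrices of [K] form a convex cone. *)
Lemma gram_mx_cone N X X' (u u' : 'I_N -> H) (t : R) : K X -> K X' -> 0 <= t ->
  exists Z w, K Z /\
    forall o, gram_mx Gamma Z w o = gram_mx Gamma X u o + t%:C *: gram_mx Gamma X' u' o.
Proof.
move=> KX KX' t0.
have [Z [E [E' [KZ lE lE' [iE iE' iEE' ZE ZE']]]]] := direct_sum_model oe ce Kfree KX KX'.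
exists Z, (fun i => E (u i) + E' ((Num.sqrt t)%:C *: u' i)); split=> // o.
have iE'E x y : inner (E' x) (E y) = 0 by rewrite innerC iEE' conjC0.
rewrite -gram_mxZ//; last exact: Klin.
apply/matrixP => m i; rewrite !mxE (linD (Gamma1_eval_linear Gamma o (Klin KZ))).
rewrite (Gamma1_eval_intertwine o _ lE ZE) (Gamma1_eval_intertwine o _ lE' ZE').
by rewrite innerDl !innerDr iE iE' iEE' iE'E addr0 add0r.
Qed.

Lemma Gamma1_eval_bound : exists2 B : 'I_r.+1 -> C, forall o, 0 <= B o &
  forall X o x, K X -> `|Gamma1_eval Gamma X o x| <= B o * `|x|.
Proof.
have /choice[B hB] (o : 'I_r.+1) : exists B : C, 0 <= B /\
    forall X x, K X -> `|Gamma1_eval Gamma X o x| <= B * `|x|.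
  rewrite /Gamma1_eval; case: unlift => [k|].
    have [B B0 hB] := free_eval_bound (H := H) (Gamma k) M0.
    by exists B; split=> // X x KX; apply: hB; exact: KM.
  by exists 1; split=> // X x _; rewrite mul1r.
by exists B => [k | X k x]; [have [] := hB k | have [_] := hB k; apply].
Qed.

Context (Y : 'I_g -> H -> H) (saY : sa_tuple Y).

(** Otherwise the cone of Gram matrices of [K] stays at distance at least [eps] from the one of [Y]
    along [e]. An approximately separating functional, perturbed and made monic, is then a pencil
    contradicting the assumption. *)
Lemma near_point_or_pencil n (eps : C) : 0 < eps ->
  (forall A : 'I_r -> 'M[C]_n.+1, (forall k, A k \is hermsymmx) ->
    (forall X, K X -> psd (pencil_eval A Gamma X)) -> psd (pencil_eval A Gamma Y)) ->
  exists X v, K X /\ gram_close Gamma e Y n.+1 eps X v.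
Proof.
move=> eps0 hpsd; apply: contrapT => hno.
have epsE : eps = (complex.Re eps)%:C by rewrite RRe_real// gtr0_real.
set er := complex.Re eps in epsE.
have er0 : 0 < er by move: eps0; rewrite epsE ltcR.
pose ue (i : 'I_n.+1) := e i.
pose G X (u : 'I_n.+1 -> H) o := gram_mx Gamma X u o.
pose p := flat_gram (G Y ue).
pose d := er ^+ 2.
have d0 : 0 < d by rewrite exprn_gt0.
have far X u : K X -> d <= re_dot (fun f => flat_gram (G X u) f - p f)
                                  (fun f => flat_gram (G X u) f - p f).
  move=> KX; rewrite leNgt; apply/negP => hlt; apply: hno.
  have ent f : `|flat_gram (G X u) f - p f| <= eps.
    rewrite -ler_sqr ?nnegrE// ?(ltW eps0)//.
    have sqE : `|flat_gram (G X u) f - p f| ^+ 2 =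
        (complex.Re (`|flat_gram (G X u) f - p f| ^+ 2 : C))%:C.
      by rewrite RRe_real// ger0_real// exprn_ge0.
    rewrite sqE epsE -[leRHS]rmorphXn lecR ltW// (le_lt_trans _ hlt)// re_dot_sq.
    rewrite (bigD1 f)//= lerDl; apply: sumr_ge0 => f' _.
    by have := exprn_ge0 2 (normr_ge0 (flat_gram (G X u) f' - p f')); rewrite lecE => /andP[].
  exists X, (fun i => u (inord i)); split=> // i l hi hl; split.
    have := ent (ord0, inord i, inord l).
    by rewrite /p /flat_gram !mxE /Gamma1_eval unlift_none /ue !inordK.
  move=> k; have := ent (lift ord0 k, inord i, inord l).
  by rewrite /p /flat_gram !mxE /Gamma1_eval liftK /ue !inordK.
have [B B0 hB] := Gamma1_eval_bound.
pose S := [set a | exists X u, K X /\ a = flat_gram (G X u)].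
(* Chosen so that the Gram vector of any [X] in [K] has squared length at most [Bt] times the square
   of [sq_size u]. *)
pose Bt : R := \sum_(f : 'I_r.+1 * 'I_n.+1 * 'I_n.+1) complex.Re (B f.1.1) ^+ 2.
(* Adding [2 delta] to the constant term leaves at least [delta * sq_size u] on [K], while at [Y]
   the value is at most [delta - d + 2 delta (n+1) = - delta]. *)
pose delta : R := d / (2 * n.+1%:R + 2).
have n0 : 0 <= n.+1%:R :> R by rewrite ler0n.
have delta0 : 0 < delta by rewrite divr_gt0//; lra.
have [|||||c [[X0 [u0 [KX0 cE]]] hc1 hc2]] :=
  @approximate_separation R _ S p d Bt delta _ _ _ d0 _ _ delta0.
- by exists (flat_gram (G (fun=> fun=> 0) ue)), (fun=> fun=> 0), ue.
- move=> _ _ t [X [u [KX ->]]] [X' [u' [KX' ->]]] t0.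
  have [Z [w [KZ hZ]]] := gram_mx_cone u u' KX KX' t0.
  by exists Z, w; split=> //; apply/funext => f; rewrite /flat_gram /G hZ !mxE.
- move=> _ t [X [u [KX ->]]] t0.
  exists X, (fun i => (Num.sqrt t)%:C *: u i); split=> //.
  by apply/funext => f; rewrite /flat_gram /G gram_mxZ ?mxE//; exact: Klin.
- by move=> _ [X [u [KX ->]]]; exact: far.
- by apply: sumr_ge0 => f _; exact: sqr_ge0.
pose Q o := G X0 u0 o - G Y ue o.
have qE : (fun f => c f - p f) = flat_gram Q.
  by apply/funext => f; rewrite cE /p /flat_gram /Q !mxE.
rewrite qE in hc1 hc2.
have hQ o : (Q o) ^t conjC = Q o.
  by rewrite /Q linearB /= map_mxB !gram_mx_herm//; exact: Ksa.
have ReQ X u : re_dot (flat_gram Q) (flat_gram (G X u)) = complex.Re (pencil_form Gamma Q X u).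
  by rewrite re_dot_flat; congr complex.Re; apply: eq_bigr => o _; rewrite hQ.
(* The perturbation makes the form positive definite on [K]. Its values at the
   tuple 0 of [K], where all [gamma_k] vanish, show that [A ord0] is positive
   definite, so that a congruence turns [A] into a monic pencil. *)
pose A o := Q o + (if o == ord0 then ((2 * delta)%:C)%:M else 0).
have hA o : (A o) ^t conjC = A o.
  rewrite /A linearD /= map_mxD hQ; congr (_ + _); case: ifP => _.
    rewrite tr_scalar_mx map_scalar_mx; congr (_%:M).
    by apply: conj_Creal; rewrite complex_real.
  by rewrite trmx0 map_mx0.
have sqE (u : 'I_n.+1 -> H) : sq_size u = (complex.Re (sq_size u))%:C.
  by rewrite RRe_real// ger0_real// sq_size_ge0.
have formA (X : 'I_g -> H -> H) u : sa_tuple X -> pencil_form Gamma A X u =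
   (complex.Re (pencil_form Gamma Q X u) + 2 * delta * complex.Re (sq_size u))%:C.
  move=> saX; rewrite pencil_formD pencil_form_scalar [in LHS]sqE -rmorphM [RHS]rmorphD.
  by congr (_ + _); apply/esym/RRe_real/CrealP; exact: pencil_form_conj.
have formA_gt0 X u : K X -> 0 < sq_size u -> 0 < pencil_form Gamma A X u.
  move=> KX su; rewrite formA; last exact: Ksa.
  rewrite sqE ltcR in su; rewrite ltcR -ReQ.
  have := hc1 (flat_gram (G X u)) (complex.Re (sq_size u)).
  move=> /(_ _ su) h; have : - (delta * complex.Re (sq_size u)) <=
      re_dot (flat_gram Q) (flat_gram (G X u)).
    apply: h; first by exists X, u.
    rewrite re_dot_sq /Bt mulr_suml; apply: ler_sum => f _.
    rewrite -exprMn; apply: Re_sqr_norm_le.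
    rewrite rmorphM /= -sqE RRe_real ?ger0_real//.
    by rewrite gram_mx_bound// => x; exact: hB.
  have : 0 < delta * complex.Re (sq_size u) by rewrite mulr_gt0.
  lra.
have formA_ge0 X u : K X -> 0 <= pencil_form Gamma A X u.
  move=> KX; have := sq_size_ge0 u; rewrite le_eqVlt => /orP[/eqP s0|su]; last first.
    by rewrite ltW// formA_gt0.
  have u0' i : u i = 0.
    apply/eqP; rewrite -normr_eq0 -sqrf_eq0; apply/eqP/le_anti.
    by rewrite exprn_ge0// andbT s0 sq_size_norm.
  rewrite /pencil_form big1// => o _; rewrite (_ : gram_mx _ _ _ _ = 0) ?mulmx0 ?mxtrace0//.
  by apply/matrixP => m i; rewrite !mxE (u0' i) inner0r.
have formAY : pencil_form Gamma A Y ue < 0.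
  rewrite formA// ltcR -ReQ.
  have -> : complex.Re (sq_size ue) = n.+1%:R.
    rewrite /sq_size; under eq_bigr do rewrite sqr_norm_inner /ue oe eqxx.
    by rewrite sumr_const card_ord -(rmorph_nat (real_complex R)).
  have h : re_dot (flat_gram Q) (flat_gram (G Y ue)) <= delta - d by [].
  have h2 : delta * (2 * n.+1%:R + 2) = d by rewrite /delta divfK//; lra.
  by lra.
have e00 : inner (e 0%N) (e 0%N) = 1 by rewrite oe eqxx.
have [||T Tu TA] := @posdef_congruent1 R n.+1 (A ord0).
- by apply/is_hermitianmxP; rewrite expr0 scale1r hA.
- move=> a a0.
  (* With this choice the Gram matrix at index 0 is the adjoint of [a] times [a], and its trace
     against [A ord0] is the form at [a]. *)
  pose u i := (a 0 i)^* *: e 0%N.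
  have su : 0 < sq_size u.
    have [i ai] : exists i, a 0 i != 0.
      apply/existsP; rewrite -negb_forall; apply: contra a0 => /forallP h.
      by apply/eqP/rowP => i; rewrite mxE; apply/eqP/h.
    rewrite (lt_le_trans _ (sq_size_norm u i))// exprn_gt0// normr_gt0.
    rewrite scaler_eq0 conjC_eq0 (negPf ai)/=; apply/eqP => e0.
    by move: e00; rewrite e0 inner0l => /esym/eqP; rewrite oner_eq0.
  have := formA_gt0 _ _ K0 su; rewrite /pencil_form big_ord_recl big1 ?addr0; last first.
    move=> k _; rewrite (_ : gram_mx _ _ _ _ = 0) ?mulmx0 ?mxtrace0//.
    by apply/matrixP => m i; rewrite !mxE /Gamma1_eval liftK Gamma0 inner0l.
  suff -> : (a *m A ord0 *m a ^t conjC) 0 0 =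
    \tr (A ord0 *m gram_mx Gamma (fun=> fun=> 0) u ord0) by [].
  have -> : gram_mx Gamma (fun=> fun=> 0) u ord0 = a ^t conjC *m a.
    apply/matrixP => m i; rewrite !mxE big_ord1 !mxE /Gamma1_eval unlift_none.
    by rewrite innerZl innerZr conjCK e00 mulr1.
  by rewrite mulmxA mxtrace_mulC mulmxA /mxtrace big_ord1.
pose A' k := T ^t conjC *m A (lift ord0 k) *m T.
have A'E : monic_family A' = fun o => T ^t conjC *m A o *m T.
  apply/funext => o; rewrite /monic_family; case: unliftP => [k ->//|->].
  by rewrite TA.
have psdY : psd (pencil_eval A' Gamma Y).
  apply: hpsd => [k|X KX u].
    apply/is_hermitianmxP; rewrite expr0 scale1r /A' !trmx_mul !map_mxM trmxCK hA.
    by rewrite mulmxA.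
  by rewrite sum_inner_pencil A'E pencil_form_congr ?formA_ge0//; exact: Klin.
(* Acting by the inverse of [T] undoes the congruence and recovers the negative value of [A] at [Y]
   and [e]. *)
have := psdY (mx_act (invmx T) ue).
rewrite sum_inner_pencil A'E pencil_form_congr; last by move=> j; have [[]] := saY j.
rewrite -mx_act_mul mulmxV// mx_act1 => h.
by have := le_lt_trans h formAY; rewrite ltxx.
Qed.

End Separation.

Theorem theorem1p5 (R : realType) (H : hilbertType R)
    (sepH : separable_space H) (infH : infinite_dimensional H)
    (g r : nat) (le_gr : (g <= r)%N)
    (Gamma : 'I_r -> free_poly R g)
    (Gamma_sym : forall k, free_symmetric (Gamma k))
    (Gamma_var : forall j : 'I_g, Gamma (widen_ord le_gr j) = free_var j)
    (Gamma0 : Gamma_eval Gamma (fun _ : 'I_g => (fun=> 0) : H -> H)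
              = (fun=> fun=> 0))
    (K : set ('I_g -> H -> H))
    (K_bounded : bounded_family K) (K_closed : sot_closed K)
    (K_convex : Gamma_convex Gamma K)
    (K0 : K (fun=> fun=> 0))
    (Y : 'I_g -> H -> H) (saY : sa_tuple Y) (KY : ~ K Y) :
  exists (N : nat) (A : 'I_r -> 'M[R[i]]_N),
    [/\ (0 < N)%N,
        forall k, A k \is hermsymmx,
        forall X, K X -> psd (pencil_eval A Gamma X)
      & ~ psd (pencil_eval A Gamma Y)].
Proof.
have [Kfree Kcompress] := K_convex.
have [Ksa _ _] := Kfree.
have [e oe ce] := complete_seq_exists sepH infH.
have [M M1 KM] := bounded_family_bound Ksa K_bounded.
have M0 : 0 <= M := le_trans ler01 M1.
(* Without a separating pencil, those of size [n.+1] give an approximation of [Y] to within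
   [1/(n+1)] for each [n], and the limit puts [Y] in [K]. *)
apply: contrapT => hno; apply: KY.
apply: (gram_limit Ksa Kcompress Gamma_sym Gamma_var M1 KM K_closed infH oe ce saY).
move=> n; apply: (near_point_or_pencil Gamma_sym Gamma0 Kfree K0 M0 KM oe ce saY).
  by rewrite invr_gt0.
move=> A hA KA; apply: contrapT => YA; apply: hno.
by exists n.+1, A.
Qed.
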